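(* Let $n\ge 1$ and $k\ge 2$. The Brin-Higman-Thompson group $nG_{k,1}$ is finitely generated. Moreover: 1. Let $\Gamma_{k,1}$ be a finite generating set of the Higman-Thompson group $G_{k,1}$, and let $\Gamma_{k,1}^{(1)}=\Gamma_{k,1}\times\{\mathbb{1}\}^{n-1}$. Then $nG_{k,1}$ is generated by $\Gamma_{k,1}^{(1)}\cup\{C_{0,i},\,C_{1,i} : 2\le i\le n\}$, and it is also generated by $\Gamma_{k,1}^{(1)}\cup\{\sigma_i^{(0)},\,\sigma_i^{(1)} : 2\le i\le n\}$. 2. Let $N_{k,1}$ be the minimum number of generators of $G_{k,1}$. The minimum number of generators of $nG_{k,1}$ is $\le N_{k,1}+2(n-1)$.
   Context: For an integer $k\ge 1$ let $A_k=\{a_0,\dots,a_{k-1}\}$ be an alphabet with $k$ letters. For an alphabet $A$, $A^*$ is the set of finite strings over $A$ (with empty string $\varepsilon$) and $A^\omega$ the set of infinite strings indexed by $\omega$. $nA^*$ is the $n$-fold direct product of the free monoid $A^*$ with coordinatewise concatenation, and $nA^\omega$ is the $n$-fold cartesian product of $A^\omega$. For $u,v\in nA^*$, $u\le_{\rm init} v$ iff $v=ux$ for some $x\in nA^*$; the join $u\vee v$ is the $\le_{\rm init}$-least common upper bound of $u$ and $v$ (it exists iff for every $i$, one of $u_i,v_i$ is a prefix of the other). A joinless code is a set $S\subseteq nA^*$ in which no two distinct elements have a join; it is maximal if it is $\subseteq$-maximal among joinless codes of $nA^*$. ''Function'' means partial function. A right-ideal morphism of $nA^*$ is a function $f:nA^*\to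 nA^*$ with $f(xw)=f(x)w$ for all $x\in{\rm Dom}(f)$, $w\in nA^*$. $n\mathcal{RI}^{\sf fin}$ is the monoid (under composition) of injective right-ideal morphisms $f$ such that ${\rm Dom}(f)={\rm domC}(f)\cdot nA^*$ and ${\rm Im}(f)={\rm imC}(f)\cdot nA^*$ for finite maximal joinless codes ${\rm domC}(f)$, ${\rm imC}(f)$. Such $f$ is determined by the bijection ${\rm domC}(f)\to{\rm imC}(f)$ (its table), and it induces a permutation $f^{(\omega)}$ of $nA^\omega$ by $f^{(\omega)}(pu)=f(p)\,u$ for $p\in{\rm domC}(f)$, $u\in nA^\omega$. For $n\ge1$, $k\ge2$, the Brin-Higman-Thompson group $nG_{k,1}$ is the group of all permutations $f^{(\omega)}$ of $nA_k^{\,\omega}$ with $f\in n\mathcal{RI}^{\sf fin}$ over the alphabet $A_k$; one says $f$ represents $f^{(\omega)}$. $G_{k,1}=1G_{k,1}$ is the Higman-Thompson group, which is known to be finitely generated. For $g\in G_{k,1}$, $g\times\mathbb{1}^{n-1}$ denotes the element of $nG_{k,1}$ that acts as $g$ on the first coordinate and as the identity on the others. Generation is in the sense of groups (inverses of generators are allowed). $\varepsilon^r$ stands for $r$ consecutive coordinates equal to $\varepsilon$. For $m\ge0$ let $P^{(m)}=\{a_{k-1}^{\,r}a_j : 0\le r\le m,\ 0\le j\le k-2\}\cup\{a_{k-1}^{\,m+1}\}$, a finite maximal prefix code of $A_k^{\,*}$. For $m\ge 0$ and $2\le i\le n$, $\sigma_i^{(m)}\in nG_{k,1}$ is given by the table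 $(p,\varepsilon^{n-1})\mapsto(\varepsilon^{i-1},p,\varepsilon^{n-i})$ for all $p\in P^{(m)}$. In particular $\sigma_i^{(0)}$ has table $(a_j,\varepsilon^{n-1})\mapsto(\varepsilon^{i-1},a_j,\varepsilon^{n-i})$, $0\le j\le k-1$. Further, $C_{0,i}=\sigma_i^{(0)}$, and $C_{1,i}\in nG_{k,1}$ is given by the table $(a_j,\varepsilon^{n-1})\mapsto(a_j,\varepsilon^{n-1})$ for $0\le j\le k-2$, and $(a_{k-1}a_j,\varepsilon^{n-1})\mapsto(a_{k-1},\varepsilon^{i-2},a_j,\varepsilon^{n-i})$ for $0\le j\le k-1$ (where $a_j$ is in coordinate $i$). *)

(* Defs.v *)
From mathcomp Require Import all_boot.
From mathcomp Require Import boolp classical_sets functions cardinality.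

Set Implicit Arguments.
Unset Strict Implicit.
Unset Printing Implicit Defensive.

Local Open Scope classical_set_scope.

Section Strings.
Variables n k : nat.

(* The letter a_j is the ordinal of value j. *)
Definition nstring := {ffun 'I_n -> seq 'I_k}.
Definition nomega := 'I_n -> nat -> 'I_k.

Definition ncat (u v : nstring) : nstring := [ffun i => u i ++ v i].

(* The default value of [nth] is returned exactly when [size s <= t]. *)
Definition ocat (s : seq 'I_k) (w : nat -> 'I_k) : nat -> 'I_k :=
  fun t => nth (w (t - size s)) s t.

Definition nocat (u : nstring) (w : nomega) : nomega :=
  fun i => ocat (u i) (w i).

Definition init_le (u v : nstring) := exists x, v = ncat u x.

Definition is_join (u v w : nstring) :=
  [/\ init_le u w, init_le v w &
      forall z, init_le u z -> init_le v z -> init_le w z].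

Definition joinless (S : set nstring) :=
  forall u v, S u -> S v -> u <> v -> ~ exists w, is_join u v w.

Definition maximal_joinless (S : set nstring) :=
  joinless S /\ forall S', joinless S' -> S `<=` S' -> S' = S.

Definition right_ideal (P : set nstring) : set nstring :=
  [set z | exists2 p, P p & exists w, z = ncat p w].

(* Partial functions of nA^* are total functions into [option nstring]. *)
Definition Dom (f : nstring -> option nstring) : set nstring :=
  [set x | exists y, f x = Some y].

Definition Im (f : nstring -> option nstring) : set nstring :=
  [set y | exists x, f x = Some y].

Definition right_ideal_morphism (f : nstring -> option nstring) :=
  forall x y w, f x = Some y -> f (ncat x w) = Some (ncat y w).

Definition pinjective (f : nstring -> option nstring) :=
  forall x x' y, f x = Some y -> f x' = Some y -> x = x'.

Definition code_of (I P : set nstring) :=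
  [/\ finite_set P, maximal_joinless P & I = right_ideal P].

Definition domC (f : nstring -> option nstring) (P : set nstring) :=
  code_of (Dom f) P.

Definition imC (f : nstring -> option nstring) (Q : set nstring) :=
  code_of (Im f) Q.

Definition nRIfin (f : nstring -> option nstring) :=
  [/\ right_ideal_morphism f, pinjective f,
      exists P, domC f P & exists Q, imC f Q].

(* [phi] is the map written f^(omega). *)
Definition is_omega (f : nstring -> option nstring) (phi : nomega -> nomega) :=
  forall P, domC f P -> forall p q u, P p -> f p = Some q ->
    phi (nocat p u) = nocat q u.

Definition represents (f : nstring -> option nstring)
    (phi : nomega -> nomega) :=
  nRIfin f /\ is_omega f phi.

Definition BHT : set (nomega -> nomega) :=
  [set phi | bijective phi /\ exists f, represents f phi].

(* [T p q] means that the table contains the entry p |-> q. *)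
Definition has_table (f : nstring -> option nstring)
    (T : nstring -> nstring -> Prop) :=
  forall P, domC f P -> forall p q, T p q <-> P p /\ f p = Some q.

(* The default value [id] is irrelevant: it is only returned when [T] is not
   the table of an element of n RI^fin. *)
Definition of_table (T : nstring -> nstring -> Prop) : nomega -> nomega :=
  @xget (nomega -> nomega) id
    [set phi | exists f, represents f phi /\ has_table f T].

Definition is_last (a : 'I_k) := a.+1 == k.

(* The set P^(m); [l] is the last letter a_{k-1}. *)
Inductive prefix_code (m : nat) : seq 'I_k -> Prop :=
| PrefixInner r (l a : 'I_k) of r <= m & is_last l & ~~ is_last a :
    prefix_code m (rcons (nseq r l) a)
| PrefixLast (l : 'I_k) of is_last l : prefix_code m (nseq m.+1 l).

(* The n-tuple with s in coordinate c and empty strings elsewhere; c is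
   numbered from 1, whereas 'I_n is numbered from 0. *)
Definition at_coord (c : nat) (s : seq 'I_k) : nstring :=
  [ffun j : 'I_n => if j.+1 == c then s else [::]].

Inductive sigma_table (m i : nat) : nstring -> nstring -> Prop :=
| SigmaEntry p of prefix_code m p :
    sigma_table m i (at_coord 1 p) (at_coord i p).

Definition sigma (m i : nat) : nomega -> nomega := of_table (sigma_table m i).

Definition C0 (i : nat) : nomega -> nomega := sigma 0 i.

Inductive C1_table (i : nat) : nstring -> nstring -> Prop :=
| C1Inner (a : 'I_k) of ~~ is_last a :
    C1_table i (at_coord 1 [:: a]) (at_coord 1 [:: a])
| C1Last (l a : 'I_k) of is_last l :
    C1_table i (at_coord 1 [:: l; a])
               (ncat (at_coord 1 [:: l]) (at_coord i [:: a])).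

Definition C1 (i : nat) : nomega -> nomega := of_table (C1_table i).

End Strings.

Arguments BHT : clear implicits.
Arguments sigma : clear implicits.
Arguments C0 : clear implicits.
Arguments C1 : clear implicits.

Definition HT (k : nat) := BHT 1 k.
Arguments HT : clear implicits.

(* g x 1^{n-1} *)
Definition times_id (n k : nat) (g : nomega 1 k -> nomega 1 k) :
    nomega n k -> nomega n k :=
  fun w i => if i == 0 :> nat then g (fun=> w i) ord0 else w i.
Arguments times_id n {k} g.

Section Generation.
Variable X : Type.

Definition perm_group (H : set (X -> X)) :=
  [/\ H id, forall f g, H f -> H g -> H (f \o g) &
      forall f g, H f -> cancel f g -> cancel g f -> H g].

Definition generates (S G : set (X -> X)) := smallest perm_group S = G.

Definition generated_by_card (G : set (X -> X)) (d : nat) :=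
  exists2 S, (S #= `I_d)%card & generates S G.

Definition min_generators (G : set (X -> X)) (d : nat) :=
  generated_by_card G d /\ forall d', generated_by_card G d' -> d <= d'.

End Generation.

(* Main.v *)
Require Import Defs.
From mathcomp Require Import all_boot.
From mathcomp Require Import boolp classical_sets functions cardinality.

(* A map is conic when it sends the cone [p nA^omega] to a cone [q nA^omega] by
   [p u |-> q u] for every [p] in some grid of words of equal lengths; the group
   [nG_{k,1}] consists of the conic bijections.

   For n = 1, given a conic bijection from a prefix code P to a prefix code Q,
   both codes contain a full set of siblings ([c a_j] and [d a_j]); swaps of
   cones of Q make the map send [c a_j] to [d a_j], hence [c] to [d], and P
   shrinks.  So swaps generate, and conjugation by swaps shortens long cones:
   the finitely many swaps at depth at most 3 suffice.

   For general n, conjugating C_1 by swaps of the first coordinate yields the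
   baker's map [(c a_j u, v) |-> (c u, a_j v)] at every cone [c].  Inverse baker's
   maps write all letters of a grid into the first coordinate.  Given phi conic on
   a grid, with images [q_p], code its domain grid by the first coordinate, refine
   each coded cone of [p] by the box needed to complete [q_p] to a uniform grid,
   and code the target grid similarly: phi becomes an element of
   [G_{k,1} x 1]. *)

Set Implicit Arguments.
Unset Strict Implicit.
Unset Printing Implicit Defensive.

Local Open Scope classical_set_scope.

(** * Infinite words, cones, and swaps of two cones *)

Section InfiniteWords.
Variable k : nat.
Implicit Types (s t p q c d : seq 'I_k) (x y u v : nat -> 'I_k).

Definition wdrop (m : nat) x : nat -> 'I_k := fun j => x (m + j).
Definition starts s x := mkseq x (size s) == s.
Definition incomp p q := ~~ prefix p q && ~~ prefix q p.
Definition cmap (g : (nat -> 'I_k) -> nat -> 'I_k) p q :=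
  forall u, g (ocat p u) = ocat q u.

Lemma ocat0 u : ocat [::] u = u.
Proof. by apply: funext => j; rewrite /ocat /= nth_nil subn0. Qed.

Lemma ocat_cat s t u : ocat (s ++ t) u = ocat s (ocat t u).
Proof.
apply: funext => j; rewrite /ocat nth_cat size_cat subnDA.
by case: ltnP => h; [exact: set_nth_default | rewrite [RHS]nth_default].
Qed.

Lemma wdrop_ocat s u : wdrop (size s) (ocat s u) = u.
Proof.
by apply: funext => j; rewrite /wdrop /ocat nth_default ?leq_addr // addKn.
Qed.

Lemma ocat_inj s : injective (ocat s).
Proof. by move=> u v /(congr1 (wdrop (size s))); rewrite !wdrop_ocat. Qed.

Lemma starts_ocat s u : starts s (ocat s u).
Proof.
apply/eqP/(@eq_from_nth _ (u 0)); rewrite size_mkseq // => i hi.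
by rewrite nth_mkseq // /ocat; apply: set_nth_default.
Qed.
#[local] Hint Resolve starts_ocat : core.

Lemma ocat_wdrop s x : starts s x -> ocat s (wdrop (size s) x) = x.
Proof.
move=> /eqP h; apply: funext => j; rewrite /ocat /wdrop.
have [hj|hj] := ltnP j (size s); last by rewrite nth_default // subnKC.
by rewrite -[in LHS]h nth_mkseq.
Qed.

Lemma startsP s x : reflect (exists u, x = ocat s u) (starts s x).
Proof.
apply: (iffP idP) => [/ocat_wdrop h|[u ->//]].
by exists (wdrop (size s) x); rewrite h.
Qed.

Lemma starts_mkseq m x : starts (mkseq x m) x.
Proof. by rewrite /starts size_mkseq. Qed.

Lemma prefix_starts s t x : prefix s t -> starts t x -> starts s x.
Proof.
by case/prefixP=> r -> /startsP[u ->]; rewrite ocat_cat.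
Qed.

Lemma starts_prefix s t x :
  starts s x -> starts t x -> size s <= size t -> prefix s t.
Proof.
move=> /eqP hs /eqP ht le; rewrite prefixE -[X in take _ X]ht /mkseq -map_take.
by rewrite take_iota (minn_idPl le) -/(mkseq x _) hs.
Qed.

Lemma starts_size_eq s t x :
  starts s x -> starts t x -> size s = size t -> s = t.
Proof. by move=> /eqP hs /eqP ht e; rewrite -hs -ht e. Qed.

Lemma incompC p q : incomp p q = incomp q p.
Proof. by rewrite /incomp andbC. Qed.

Lemma incomp_starts p q x : incomp p q -> starts p x -> starts q x = false.
Proof.
case/andP=> h1 h2 hp; apply/negP => hq.
have [le|/ltnW le] := leqP (size p) (size q).
  by rewrite (starts_prefix hp hq le) in h1.
by rewrite (starts_prefix hq hp le) in h2.
Qed.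

(** The word [x0] rules out the empty alphabet, over which there are no infinite words and the
    right-hand side would hold vacuously. *)
Lemma incompP p q x0 :
  reflect (forall u v, ocat p u <> ocat q v) (incomp p q).
Proof.
apply: (iffP idP) => [h u v e|h].
  by have := incomp_starts h (starts_ocat p u); rewrite e starts_ocat.
apply/andP; split; apply/negP => /prefixP[r e].
  by apply: (h (ocat r x0) x0); rewrite e ocat_cat.
by apply: (h x0 (ocat r x0)); rewrite e ocat_cat.
Qed.

Lemma cmap_cat g p q r : cmap g p q -> cmap g (p ++ r) (q ++ r).
Proof. by move=> h u; rewrite !ocat_cat h. Qed.

Lemma cmap_comp g h p q r : cmap g p q -> cmap h q r -> cmap (h \o g) p r.
Proof. by move=> hg hh u /=; rewrite hg hh. Qed.

Definition swap p q x :=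
  if starts p x then ocat q (wdrop (size p) x)
  else if starts q x then ocat p (wdrop (size q) x) else x.

Section Swap.
Variables p q : seq 'I_k.
Hypothesis pq : incomp p q.

Lemma swap_l : cmap (swap p q) p q.
Proof. by move=> u; rewrite /swap starts_ocat wdrop_ocat. Qed.

Lemma swap_r : cmap (swap p q) q p.
Proof.
move=> u; rewrite /swap (incomp_starts _ (starts_ocat q u)) 1?incompC //.
by rewrite starts_ocat wdrop_ocat.
Qed.

Lemma swap_id x : ~~ starts p x -> ~~ starts q x -> swap p q x = x.
Proof. by rewrite /swap => /negPf-> /negPf->. Qed.

Variant swap_spec x : Prop :=
| SwapL u of x = ocat p u
| SwapR u of x = ocat q u
| SwapN of ~~ starts p x & ~~ starts q x.

Lemma swapP x : swap_spec x.
Proof.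
have [/startsP[u ->]|hp] := boolP (starts p x); first exact: SwapL.
by have [/startsP[u ->]|hq] := boolP (starts q x); [exact: SwapR|exact: SwapN].
Qed.

Lemma swapK : involutive (swap p q).
Proof.
move=> x; case: (swapP x) => [u ->|u ->|hp hq].
- by rewrite swap_l swap_r.
- by rewrite swap_r swap_l.
- by rewrite !swap_id.
Qed.

Lemma swap_incomp r : incomp p r -> incomp q r -> cmap (swap p q) r r.
Proof.
by move=> pr qr u; rewrite swap_id // (incomp_starts _ (starts_ocat r u)) // incompC.
Qed.

End Swap.

Lemma swapC p q : incomp p q -> swap p q = swap q p.
Proof.
move=> pq; have qp : incomp q p by rewrite incompC.
apply: funext => x; case: (swapP p q x) => [u ->|u ->|hp hq].
- by rewrite swap_l // swap_r.
- by rewrite swap_r // swap_l.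
- by rewrite !swap_id.
Qed.

Lemma cmap_incomp g p q p' q' : injective g -> cmap g p p' -> cmap g q q' ->
  incomp p q -> incomp p' q'.
Proof.
(* A word that is incomparable with another is nonempty, so [p] supplies a letter for the filler
   word. *)
case: p => [|a p] gi gp gq pq; first by rewrite /incomp prefix0s in pq.
pose x0 : nat -> 'I_k := fun=> a.
apply/(incompP _ _ x0) => u v; rewrite -gp -gq => /gi.
exact/(incompP _ _ x0).
Qed.

(** With [g] itself a swap, this trades a swap of long cones for a swap of shorter ones. *)
Lemma swap_conj g p q p' q' : involutive g -> cmap g p p' -> cmap g q q' ->
  incomp p q -> swap p q = g \o swap p' q' \o g.
Proof.
move=> gK gp gq pq; have gi := can_inj gK.
have pq' := cmap_incomp gi gp gq pq.
apply: funext => x /=; case: (swapP p q x) => [u ->|u ->|hp hq].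
- by rewrite swap_l // gp swap_l // -gq gK.
- by rewrite swap_r // gq swap_r // -gp gK.
rewrite !swap_id ?gK //.
  apply: contra hp => /startsP[u]; rewrite -gp => /gi ->; exact: starts_ocat.
by apply: contra hq => /startsP[u]; rewrite -gq => /gi ->; exact: starts_ocat.
Qed.

End InfiniteWords.
#[global] Hint Resolve starts_ocat : core.

(** * Generation by swaps in one coordinate *)

Lemma letter_neq k (a : 'I_k) : 2 <= k -> exists b : 'I_k, b != a.
Proof.
move=> k2; have k0 : 0 < k by apply: ltn_trans k2.
have [a0|a0] := eqVneq (a : nat) 0.
  by exists (Ordinal k2); rewrite -val_eqE /= a0.
by exists (Ordinal k0); rewrite -val_eqE /= eq_sym.
Qed.

Section WordGroup.
Variable k : nat.
Hypothesis k_ge2 : 2 <= k.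
Implicit Types (s t p q c d : seq 'I_k) (x y u v : nat -> 'I_k).
Variable H : set ((nat -> 'I_k) -> nat -> 'I_k).
Hypothesis H_group : perm_group H.

Let H1 : H id. Proof. by case: H_group. Qed.
Let HM f g : H f -> H g -> H (f \o g). Proof. by case: H_group => _ h _; exact: h. Qed.

Let prefix2 (a b : 'I_k) s t :
  prefix (a :: s) (b :: t) = (a == b) && prefix s t.
Proof. by rewrite /prefix. Qed.

(** The word [q] is nonempty, as it is no prefix of [p]. If [q] and [c] share their first letter,
    [c'] starts with a different one; otherwise [c'] keeps the first letter of [c], which separates
    it from [q], and changes the second. *)
Lemma swap_shorten c p q : prefix c p -> ~~ prefix q p -> 3 <= size c ->
  exists c', [/\ size c' = 2, incomp c c' & prefix c q \/ incomp q c'].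
Proof.
case: c => [//|c0 [//|c1 [//|c2 c]]] cp qp _.
have [b0 nb0] := letter_neq c0 k_ge2; have [b1 nb1] := letter_neq c1 k_ge2.
case: q qp => [|q0 q] qp; first by rewrite prefix0s in qp.
have [e|ne] := eqVneq q0 c0.
  exists [:: b0; b1]; split=> //; last right; rewrite /incomp !prefix2.
    by rewrite (negPf nb0) eq_sym (negPf nb0).
  by rewrite e (negPf nb0) eq_sym (negPf nb0).
exists [:: c0; b1]; split=> //; last right; rewrite /incomp !prefix2.
  by rewrite (negPf nb1) [c1 == _]eq_sym (negPf nb1) !andbF.
by rewrite (negPf ne) eq_sym (negPf ne).
Qed.

(** Induction on the sum of the lengths. If [p] is longer than 3, its prefix [c] of length 3 is
    swapped with a word [c'] of length 2. This shortens [p] by one letter, and [q] is shortened too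
    or left alone, so the conjugated swap has a smaller sum. *)
Lemma small_swaps :
  (forall p q, size p <= 3 -> size q <= 3 -> incomp p q -> H (swap p q)) ->
  forall p q, incomp p q -> H (swap p q).
Proof.
move=> Hs p q; have [N] := ubnP (size p + size q).
elim: N p q => // N IH.
have main p q : size p + size q < N.+1 -> 3 < size p -> incomp p q -> H (swap p q).
  move=> sN p3 pq; have [npq nqp] := andP pq.
  pose c := take 3 p; pose r := drop 3 p.
  have ep : p = c ++ r by rewrite cat_take_drop.
  have sc : size c = 3 by rewrite size_takel // ltnW.
  have cp : prefix c p by rewrite ep prefix_prefix.
  have [|c' [sc' cc' cq]] := swap_shorten cp nqp; first by rewrite sc.
  have pc' : cmap (swap c c') p (c' ++ r).
    by rewrite {1}ep; apply: cmap_cat; apply: swap_l.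
  have lp : size (c' ++ r) < size p by rewrite ep !size_cat sc sc'.
  have Hc : H (swap c c') by apply: Hs => //; rewrite ?sc ?sc'.
  suff [q' qq' lq] : exists2 q', cmap (swap c c') q q' & size q' <= size q.
    rewrite (swap_conj (swapK cc') pc' qq' pq); apply: (HM _ Hc); apply: (HM Hc).
    apply: IH.
      by apply: leq_trans (_ : size p + size q <= N); rewrite -?addSn ?leq_add.
    exact: cmap_incomp (can_inj (swapK cc')) pc' qq' pq.
  have [/prefixP[z eq]|ncq] := boolP (prefix c q).
    exists (c' ++ z); last by rewrite eq !size_cat sc sc' leq_add2r.
    by rewrite eq; apply: cmap_cat; apply: swap_l.
  case: cq => [cq|qc']; first by rewrite cq in ncq.
  exists q => //; apply: swap_incomp => //; last by rewrite incompC.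
  (* If [q] were a prefix of [c], it would be one of [p]. *)
  by rewrite /incomp ncq; apply: contra nqp => /prefix_trans; apply.
move=> p q sN pq.
have [p3|p3] := ltnP 3 (size p); first exact: main.
have [q3|q3] := ltnP 3 (size q); last exact: Hs.
by rewrite swapC //; apply: main; rewrite 1?addnC 1?incompC.
Qed.

Lemma max_size_mem (P : seq (seq 'I_k)) p0 : p0 \in P ->
  exists2 p, p \in P & forall q, q \in P -> size q <= size p.
Proof.
elim: P p0 => // r P IH p0 _; case: P IH => [_|r' P IH].
  by exists r => [|q]; rewrite inE // => /eqP->.
have [p pP mp] := IH r' (mem_head _ _).
have [le|le] := leqP (size r) (size p).
  exists p => [|q]; rewrite inE; first by rewrite pP orbT.
  by case/orP => [/eqP->//|]; exact: mp.
exists r => [|q]; first exact: mem_head.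
by rewrite inE => /orP[/eqP->//|/mp h]; apply: leq_trans h (ltnW le).
Qed.

(** With [disjoint_code], this makes [P] a maximal prefix code. Both are phrased by infinite words,
    so that they pass from [P] to its image under a conic bijection. *)
Definition covering (P : seq (seq 'I_k)) :=
  forall x, exists2 p, p \in P & starts p x.
Definition disjoint_code (P : seq (seq 'I_k)) :=
  forall p q x, p \in P -> q \in P -> starts p x -> starts q x -> p = q.

(** A longest word [rcons c b] of the code has all its siblings in the code: a code word meeting the
    cone of [rcons c a] is no longer than it, and if shorter it would be a prefix of [c], hence of
    [rcons c b]. *)
Lemma caret_mem P : covering P -> disjoint_code P ->
  [::] \in P \/ exists c, forall a, rcons c a \in P.
Proof.
move=> cov dis; pose x0 : nat -> 'I_k := fun=> Ordinal k_ge2.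
have [p0 p0P _] := cov x0; have [p] := max_size_mem p0P.
case/lastP: p => [|c b] pP mp; [by left|right; exists c => a].
have [q qP qx] := cov (ocat (rcons c a) x0).
have := mp _ qP; rewrite size_rcons leq_eqVlt => /orP[/eqP sq|sq].
  by rewrite -(starts_size_eq qx (starts_ocat _ _)) ?size_rcons.
have qc : prefix q c.
  move: qx; rewrite -cats1 ocat_cat => /starts_prefix; apply; last by [].
  exact: starts_ocat.
have e : q = rcons c b.
  apply: (dis _ _ (ocat (rcons c b) x0)) => //.
  apply: prefix_starts (starts_ocat _ _); apply: prefix_trans qc _.
  by rewrite -cats1 prefix_prefix.
by move: sq; rewrite e size_rcons ltnn.
Qed.

Hypothesis H_swap : forall p q, incomp p q -> H (swap p q).

(* [g'] is [g] followed by swaps of cones of [Q], one for each letter of [s]. *)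
Lemma move_caret (P Q : seq (seq 'I_k)) g img c d (s : seq 'I_k) :
  (forall a, rcons c a \in P) -> (forall a, rcons d a \in Q) ->
  disjoint_code Q ->
  bijective g -> (forall p, p \in P -> cmap g p (img p)) ->
  (forall p, p \in P -> img p \in Q) ->
  exists g' img', [/\ H g' -> H g, bijective g',
    forall p, p \in P -> cmap g' p (img' p),
    forall p, p \in P -> img' p \in Q &
    forall a, a \in s -> img' (rcons c a) = rcons d a].
Proof.
move=> cP dQ disQ gbij gP gQ.
elim: s => [|a s [g' [img' [Hg' bg' g'P g'Q g's]]]]; first by exists g, img.
pose q := img' (rcons c a); pose r := rcons d a.
have [qr|qr] := eqVneq q r.
  by exists g', img'; split=> // b; rewrite inE => /orP[/eqP->//|/g's].
have qQ : q \in Q by apply: g'Q.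
have rQ : r \in Q by apply: dQ.
have inc p p' : p \in Q -> p' \in Q -> p != p' -> incomp p p'.
  move=> pQ p'Q /eqP ne; apply/(incompP _ _ (fun=> a)) => u v e.
  apply: ne; apply: (disQ _ _ (ocat p u)) => //; rewrite e; exact: starts_ocat.
have qri := inc _ _ qQ rQ qr.
exists (swap q r \o g'), (fun p => if img' p == q then r else
  if img' p == r then q else img' p); split.
- move=> h; apply: Hg'.
  have -> : g' = swap q r \o (swap q r \o g').
    by apply: funext => x /=; rewrite swapK.
  exact: HM (H_swap qri) h.
- apply: bij_comp bg'; exact: inv_bij (swapK qri).
- move=> p pP; apply: (cmap_comp (g'P _ pP)).
  case: eqP => [->|/eqP nq]; first exact: swap_l.
  case: eqP => [->|/eqP nr]; first exact: swap_r.
  by apply: swap_incomp => //; apply: inc; rewrite ?g'Q // eq_sym.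
- by move=> p pP; case: eqP => // _; case: eqP => // _; apply: g'Q.
- move=> b; rewrite inE -/q; have [->|ba] := eqVneq b a; first by rewrite eqxx.
  (* The letters already treated stay in place: the image of [rcons c b] is not [q], since [g'] is
     injective, and not [r], since [b] differs from [a]. *)
  move=> /= bs; have e := g's b bs; case: eqP => [eb|_].
    case/eqP: ba; pose x0 : nat -> 'I_k := fun=> a.
    have : ocat (rcons c b) x0 = ocat (rcons c a) x0.
      by apply: (bij_inj bg'); rewrite (g'P _ (cP b)) (g'P _ (cP a)) eb.
    move=> eq; have := starts_ocat (rcons c b) x0; rewrite eq => h.
    have := starts_size_eq h (starts_ocat (rcons c a) x0); rewrite !size_rcons.
    by case/(_ erefl)/rcons_inj.
  by rewrite e; case: eqP => // /rcons_inj[/eqP]; rewrite (negPf ba).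
Qed.

(** Induction on the size of [P]. If one of [P] and [Q] contains the empty word, both have a single
    word, and [g] is the identity. Otherwise [move_caret] matches a caret of [P] with one of [Q],
    and the caret at [c] is contracted. *)
Lemma swaps_generate_code N (P : seq (seq 'I_k)) g : size P < N -> uniq P ->
  covering P -> disjoint_code P -> bijective g ->
  (forall p, p \in P -> exists q, cmap g p q) -> H g.
Proof.
pose x0 : nat -> 'I_k := fun=> Ordinal k_ge2.
elim: N P g => // N IH P g sP uP cov dis gbij gP.
have [a1 a01] := letter_neq (x0 0) k_ge2.
have [img gimg] : exists img, forall p, p \in P -> cmap g p (img p).
  have [|img h] := @choice _ _ (fun p q => p \in P -> cmap g p q).
    move=> p; have [/gP[q]|] := boolP (p \in P); last by exists p.
    by exists q.
  by exists img.
pose Q := map img P.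
have gQ p : p \in P -> img p \in Q by apply: map_f.
have covQ : covering Q.
  case: (gbij) => gi gK giK x; have [p pP /startsP[u e]] := cov (gi x).
  exists (img p); first exact: gQ.
  by rewrite -(giK x) e gimg.
have disP p p' u u' : p \in P -> p' \in P -> ocat (img p) u = ocat (img p') u' -> p = p'.
  move=> pP p'P; rewrite -!gimg // => /(bij_inj gbij) e.
  by apply: (dis _ _ (ocat p u)) => //; rewrite e.
have disQ : disjoint_code Q.
  move=> _ _ x /mapP[p pP ->] /mapP[p' p'P ->] /startsP[u ->] /startsP[u' e].
  by rewrite (disP p p' u u').
have nil_P p p' : [::] \in P -> p \in P -> p' \in P -> p = p'.
  have e r : [::] \in P -> r \in P -> r = [::].
    by move=> nP rP; apply: (dis _ _ (ocat r x0)).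
  by move=> nP pP p'P; rewrite (e p) // (e p').
have nil_Q p p' : [::] \in Q -> p \in P -> p' \in P -> p = p'.
  case/mapP=> r rP er pP p'P; transitivity r.
    by apply: (disP _ _ x0 (ocat (img p) x0)); rewrite // -er ocat0.
  by apply: (disP _ _ (ocat (img p') x0) x0); rewrite // -er ocat0.
have caret2 (R : seq (seq 'I_k)) c : (forall a, rcons c a \in R) ->
    (forall p p', p \in R -> p' \in R -> p = p') -> False.
  move=> h1 h2; have /rcons_inj[/eqP] := h2 _ _ (h1 a1) (h1 (x0 0)).
  by rewrite (negPf a01).
have [nP|[c cP]] := caret_mem cov dis; have [nQ|[d dQ]] := caret_mem covQ disQ.
- case/mapP: nQ => p pP e; have := gimg p pP; rewrite -e (nil_P p [::]) // => g1.
  by have -> : g = id by apply: funext => x; rewrite -{1}(ocat0 x) g1 ocat0.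
- exfalso; apply: (caret2 _ _ dQ) => _ _ /mapP[p pP ->] /mapP[p' p'P ->].
  by rewrite (nil_P p p').
- by exfalso; apply: (caret2 _ _ cP) => p p' pP p'P; exact: nil_Q.
have [g' [img' [Hg' bg' g'P g'Q g's]]] :=
  move_caret (enum 'I_k) cP dQ disQ gbij gimg gQ.
apply: Hg'; have pc a : prefix c (rcons c a) by rewrite -cats1 prefix_prefix.
pose P' := c :: [seq p <- P | ~~ prefix c p].
apply: (IH P') => //.
(* The size drops because at least two words, given by the two distinct letters [a1] and [x0 0], are
   replaced by the one word [c]. *)
- rewrite -ltnS; apply: leq_trans sP; rewrite /= !ltnS size_filter.
  rewrite -[X in _ < X](count_predC (prefix c)) -[_ < _]/(2 + count _ P <= _).
  rewrite leq_add2r -size_filter.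
  apply: (@uniq_leq_size _ [:: rcons c a1; rcons c (x0 0)]).
    by rewrite /= inE andbT; apply/eqP => /rcons_inj[/eqP]; rewrite (negPf a01).
  by move=> p; rewrite !inE mem_filter => /orP[] /eqP->; rewrite pc cP.
- by rewrite /= filter_uniq // mem_filter prefix_refl.
- move=> x; have [p pP px] := cov x; have [cp|cp] := boolP (prefix c p).
    by exists c; [exact: mem_head|exact: prefix_starts px].
  by exists p => //; rewrite inE mem_filter cp pP orbT.
(* A word of [P] that meets the cone of [c] without extending [c] is a prefix of [c], hence of
   [rcons c a1], and so equals that code word, which does extend [c]. *)
- have aux p x : p \in P -> ~~ prefix c p -> starts c x -> starts p x -> False.
    move=> pP ncp cx px; case/negP: (ncp).
    have [le|/ltnW le] := leqP (size c) (size p); first exact: starts_prefix cx px le.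
    have ppc := starts_prefix px cx le.
    rewrite (dis p (rcons c a1) (ocat (rcons c a1) x0)) //.
    by apply: prefix_starts (starts_ocat _ _); apply: prefix_trans (pc _).
  move=> p q x; rewrite !inE !mem_filter.
  move=> /orP[/eqP->|/andP[np pP]] /orP[/eqP->|/andP[nq qP]] // px qx.
  + by case: (aux q x).
  + by case: (aux p x).
  + exact: dis qx.
- move=> p; rewrite inE mem_filter => /orP[/eqP->|/andP[_ pP]]; last first.
    by exists (img' p); apply: g'P.
  (* Splitting off the first letter of [u] reduces the claim for [c] to the matched siblings. *)
  exists d => u; have -> : u = ocat [:: u 0] (wdrop 1 u).
    by rewrite (ocat_wdrop (s := [:: u 0])) // /starts.
  by rewrite -!ocat_cat !cats1 g'P // g's // mem_enum.
Qed.

Lemma swaps_generate L g : bijective g ->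
  (forall p, size p = L -> exists q, cmap g p q) -> H g.
Proof.
move=> gbij gL; pose P := map val (enum {: L.-tuple 'I_k}).
apply: (@swaps_generate_code _ P) (leqnn _) _ _ _ gbij _.
- by rewrite map_inj_uniq ?enum_uniq //; exact: val_inj.
- move=> x; exists (mkseq x L); last exact: starts_mkseq.
  by apply/mapP; exists [tuple of mkseq x L]; rewrite ?mem_enum.
- move=> _ _ x /mapP[t _ ->] /mapP[t' _ ->] tx t'x.
  by apply: (starts_size_eq tx t'x); rewrite !size_tuple.
- by move=> _ /mapP[t _ ->]; apply: gL; rewrite size_tuple.
Qed.

End WordGroup.

(** * Cones of tuples, joins and joinless codes *)

Section Cones.
Variables n k : nat.
Hypothesis k_ge2 : 2 <= k.
Implicit Types (p q r z : nstring n k) (u v w : nomega n k).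
Implicit Types (phi psi : nomega n k -> nomega n k) (P Q S : set (nstring n k)).

Let w0 : nomega n k := fun _ _ => Ordinal k_ge2.

Definition ncmap phi p q := forall u, phi (nocat p u) = nocat q u.
Definition cone p : set (nomega n k) := [set w | exists u, w = nocat p u].
Definition trunc L w : nstring n k := [ffun i => mkseq (w i) L].
Definition nempty : nstring n k := [ffun=> [::]].

Lemma coneP p w : cone p w <-> forall i, starts (p i) (w i).
Proof.
split=> [[u -> i]|h]; first exact: starts_ocat.
exists (fun i => wdrop (size (p i)) (w i)).
by apply: funext => i; rewrite /nocat ocat_wdrop.
Qed.

Lemma cone_nocat p u : cone p (nocat p u). Proof. by exists u. Qed.

Lemma nocat_cat p z u : nocat (ncat p z) u = nocat p (nocat z u).
Proof. by apply: funext => i; rewrite /nocat ffunE ocat_cat. Qed.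

Lemma cone_trunc L w : cone (trunc L w) w.
Proof. by apply/coneP => i; rewrite ffunE starts_mkseq. Qed.

Lemma cone_size_eq p q w : cone p w -> cone q w ->
  (forall i, size (p i) = size (q i)) -> p = q.
Proof.
move=> /coneP hp /coneP hq e; apply/ffunP => i.
exact: starts_size_eq (hp i) (hq i) (e i).
Qed.

Lemma cone_init_le p q w : cone p w -> cone q w ->
  (forall i, size (p i) <= size (q i)) -> init_le p q.
Proof.
move=> /coneP hp /coneP hq e; exists [ffun i => drop (size (p i)) (q i)].
apply/ffunP => i; rewrite !ffunE.
by have /prefixP[r ->] := starts_prefix (hp i) (hq i) (e i); rewrite drop_size_cat.
Qed.

Lemma init_le_cone p q w : init_le p q -> cone q w -> cone p w.
Proof. by case=> z -> [u ->]; exists (nocat z u); rewrite nocat_cat. Qed.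

Lemma init_le_prefix p q : init_le p q -> forall i, prefix (p i) (q i).
Proof. by case=> z -> i; rewrite ffunE prefix_prefix. Qed.

(** Prefixes of one infinite word are comparable, so when the cones meet the join takes the longer
    entry in each coordinate. Conversely, the cone of a join lies in both cones. *)
Lemma joinP p q : (exists r, is_join p q r) <-> exists w, cone p w /\ cone q w.
Proof.
split=> [[r [pr qr _]]|[w [hp hq]]].
  by exists (nocat r w0); split; [apply: init_le_cone pr _|apply: init_le_cone qr _];
    exact: cone_nocat.
pose r : nstring n k := [ffun i => if size (p i) <= size (q i) then q i else p i].
have hr : cone r w.
  apply/coneP => i; rewrite ffunE; move/coneP: hp => hp; move/coneP: hq => hq.
  by case: ifP.
exists r; split.
- by apply: cone_init_le hp hr _ => i; rewrite ffunE; case: ifP.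
- apply: cone_init_le hq hr _ => i; rewrite ffunE; case: ifP => // /negbT.
  by rewrite -ltnNge => /ltnW.
move=> z pz qz; apply: (@cone_init_le r z (nocat z w0)); last first.
- move=> i; have := init_le_prefix pz i; have := init_le_prefix qz i.
  by rewrite ffunE; case: ifP => _ /size_prefix ? /size_prefix.
- exact: cone_nocat.
apply/coneP => i.
have /coneP/(_ i) := init_le_cone pz (cone_nocat z w0).
have /coneP/(_ i) := init_le_cone qz (cone_nocat z w0).
by rewrite [r i]ffunE; case: ifP.
Qed.

Lemma ncmap_cat phi p q z : ncmap phi p q -> ncmap phi (ncat p z) (ncat q z).
Proof. by move=> h u; rewrite !nocat_cat h. Qed.

Lemma ncmap_comp phi psi p q r :
  ncmap phi p q -> ncmap psi q r -> ncmap (psi \o phi) p r.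
Proof. by move=> h1 h2 u /=; rewrite h1 h2. Qed.

Lemma ncmap_inv phi psi p q : cancel phi psi -> ncmap phi p q -> ncmap psi q p.
Proof. by move=> K h u; rewrite -h K. Qed.

(** If an entry of [p] were shorter than that of [q], continuing with the constant word on [a] would
    force the next letter of [q] to be [a], for every [a]; two distinct letters contradict this. *)
Lemma nocat_eq p q : (forall u, nocat p u = nocat q u) -> p = q.
Proof.
have le p' q' : (forall u, nocat p' u = nocat q' u) ->
    forall i, size (q' i) <= size (p' i).
  move=> h i; rewrite leqNgt; apply/negP => lt.
  have e (a : 'I_k) : a = nth a (q' i) (size (p' i)).
    have /(congr1 (fun w => w i (size (p' i)))) := h (fun _ _ => a).
    by rewrite /nocat /ocat nth_default // => ->; apply: set_nth_default.
  have [b nb] := letter_neq (Ordinal k_ge2) k_ge2.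
  case/eqP: nb; rewrite (e b) [RHS]e; exact: set_nth_default.
move=> h; apply: (@cone_size_eq _ _ (nocat p w0)); first exact: cone_nocat.
  by rewrite h; exact: cone_nocat.
by move=> i; apply/eqP; rewrite eqn_leq !le.
Qed.

Lemma ncmap_uniq phi p q q' : ncmap phi p q -> ncmap phi p q' -> q = q'.
Proof. by move=> h h'; apply: nocat_eq => u; rewrite -h h'. Qed.

Lemma bounded_finite (L : nat) :
  finite_set [set p : nstring n k | forall i, size (p i) <= L].
Proof.
pose F (f : {ffun 'I_n -> L.-bseq 'I_k}) : nstring n k := [ffun i => val (f i)].
apply: (@sub_finite_set _ _ (F @` setT)); last first.
  by apply: finite_image; exact: finite_finset.
move=> p /= hp; exists [ffun i => insub_bseq L (p i)] => //.
by apply/ffunP => i; rewrite !ffunE /= /insub_bseq insubdK // -topredE /= hp.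
Qed.

Lemma finite_bounded P : finite_set P ->
  exists L, forall p, P p -> forall i, size (p i) <= L.
Proof.
move=> /finite_seqP[s ->]; elim: s => [|p s [L IH]]; first by exists 0.
exists (maxn L (\max_i size (p i))) => q /=; rewrite inE => /orP[/eqP->|qs] i.
  by rewrite leq_max leq_bigmax orbT.
by rewrite leq_max IH.
Qed.

Definition partitioning P :=
  (forall w, exists2 p, P p & cone p w) /\
  (forall p q w, P p -> P q -> cone p w -> cone q w -> p = q).

Lemma partitioning_maximal P : partitioning P -> maximal_joinless P.
Proof.
move=> [cov dis]; split=> [p q Pp Pq ne /joinP[w [pw qw]]|S' jS' sub].
  exact: ne (dis _ _ _ Pp Pq pw qw).
apply/seteqP; split=> // s Ss; have [p Pp pw] := cov (nocat s w0).
have [->//|ne] := EM (s = p).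
case: (jS' s p Ss (sub _ Pp) ne); apply/joinP; exists (nocat s w0).
by split=> //; exact: cone_nocat.
Qed.

(** If [p] met nothing in [P], adding it would keep the code joinless; by maximality [p] would lie
    in [P] and meet itself. *)
Lemma maximal_meet P p : maximal_joinless P ->
  exists2 q, P q & exists w, cone p w /\ cone q w.
Proof.
move=> [jP mP]; apply: contrapT => h.
have nj q : P q -> ~ exists r, is_join p q r.
  by move=> Pq /joinP hw; apply: h; exists q.
apply: h; exists p; last by exists (nocat p w0); split; exact: cone_nocat.
rewrite -(mP (P `|` [set p])); first by right.
  move=> q r [Pq|->] [Pr|->] // ne.
  - exact: jP.
  - move=> [s [h1 h2 h3]]; apply: (nj q) => //; exists s.
    by split=> // z h4 h5; apply: h3.
  - exact: nj.
by move=> q Pq; left.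
Qed.

(** By symmetry a right ideal has at most one joinless code. Some [q] in [Q] is below [p], and some
    [r] in [P] is below [q]; then [r] and [p] have a join, so [r = p], and [q] is squeezed between
    them. *)
Lemma joinless_sub P Q : joinless P ->
  right_ideal P = right_ideal Q -> joinless Q -> P `<=` Q.
Proof.
move=> jP e jQ p Pp; have init_refl q : init_le q q.
  by exists nempty; apply/ffunP => i; rewrite !ffunE cats0.
have : right_ideal Q p by rewrite -e; exists p => //; exact: init_refl.
case=> q Qq qp; have : right_ideal P q by rewrite e; exists q => //; exact: init_refl.
case=> r Pr rq.
have join q' r' : init_le q' r' -> exists w, cone q' w /\ cone r' w.
  move=> h; exists (nocat r' w0); split; last exact: cone_nocat.
  exact: init_le_cone h (cone_nocat _ _).
have rp : r = p.
  apply: contrapT => ne; case: (jP _ _ Pr Pp ne); apply/joinP/join.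
  case: rq qp => z -> [z' ->]; exists (ncat z z').
  by apply/ffunP => i; rewrite !ffunE catA.
suff -> : p = q by [].
apply/ffunP => i; have := init_le_prefix rq i; have := init_le_prefix qp i.
rewrite rp => h1 h2; apply/eqP.
move: (size_prefix h1) (size_prefix h2) => l1 l2.
have [s es] := prefixP h1; move: l2; rewrite es size_cat -[X in _ <= X]addn0 leq_add2l.
by rewrite leqn0 size_eq0 => /eqP->; rewrite cats0.
Qed.

End Cones.

(** * Tables of permutations, and the group as the set of conic bijections *)

Section Tables.
Variables n k : nat.
Hypothesis k_ge2 : 2 <= k.
Implicit Types (p q r z : nstring n k) (u v w : nomega n k).
Implicit Types (phi psi : nomega n k -> nomega n k) (P Q S : set (nstring n k)).

Let w0 : nomega n k := fun _ _ => Ordinal k_ge2.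

Section Representation.
Variables (phi : nomega n k -> nomega n k).
Variable T : nstring n k -> nstring n k -> Prop.
Variable rep : nomega n k -> nstring n k.
Hypothesis phi_bij : bijective phi.
Hypothesis T_finite : finite_set [set p | exists q, T p q].
Hypothesis T_rep : forall p q w, T p q -> cone p w -> p = rep w.
Hypothesis rep_cone : forall w, cone (rep w) w.
Hypothesis rep_T : forall w, exists q, T (rep w) q.
Hypothesis T_ncmap : forall p q, T p q -> ncmap phi p q.

Let domT : set (nstring n k) := [set p | exists q, T p q].
Let imT : set (nstring n k) := [set q | exists p, T p q].

Let init_refl p : init_le p p.
Proof. by exists (nempty n k); apply/ffunP => i; rewrite !ffunE cats0. Qed.

Let T_fun p q q' : T p q -> T p q' -> q = q'.
Proof. by move=> /T_ncmap h /T_ncmap h'; apply: (ncmap_uniq k_ge2 h h'). Qed.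

Let domT_partitioning : partitioning domT.
Proof.
split=> [w|p q w [p' Tp] [q' Tq] pw qw]; first by exists (rep w).
by rewrite (T_rep Tp pw) (T_rep Tq qw).
Qed.

Let imT_partitioning : partitioning imT.
Proof.
case: (phi_bij) => ph K K'; split=> [w|q q' w [p Tp] [p' Tp'] [u ->] [u' e]].
  have [q Tq] := rep_T (ph w); exists q; first by exists (rep (ph w)).
  have [u e] := rep_cone (ph w); exists u.
  by rewrite -(T_ncmap Tq) -e K'.
have {}e : nocat p u = nocat p' u'.
  by apply: (bij_inj phi_bij); rewrite (T_ncmap Tp) (T_ncmap Tp').
have pp' : p = p'.
  by rewrite (T_rep Tp (cone_nocat p u)) e; apply/esym/(T_rep Tp')/cone_nocat.
by rewrite pp' in Tp; apply: T_fun Tp Tp'.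
Qed.

Let imT_finite : finite_set imT.
Proof.
apply: sub_finite_set (finite_image (fun p => xget p [set q | T p q]) T_finite).
move=> q [p Tp]; exists p; first by exists q.
by apply: (T_fun _ Tp); apply: (xgetPex p (P := [set q | T p q])); exists q.
Qed.

(** Here [rep w] is the one domain entry whose cone contains [w]. The domain cones thus partition
    the space, and since [phi] is bijective so do the image cones; both codes are then maximal
    joinless. *)
Lemma table_represents : exists f, represents f phi /\ has_table f T.
Proof.
(* The partial function is read off from [phi] itself: a cone has at most one image word, so no
   entry below [x] has to be chosen. *)
pose R x y := ncmap phi x y /\ exists2 p, domT p & init_le p x.
have [f fE] : exists f, forall x y, f x = Some y <-> R x y.
  exists (fun x => if pselect (exists y, R x y) is left h
    then Some (projT1 (cid h)) else None).
  move=> x y; case: pselect => [h|h]; last first.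
    by split=> // r; case: h; exists y.
  case: cid => y' /= r; split=> [[<-]//|r'].
  by congr Some; apply: (ncmap_uniq k_ge2 r.1 r'.1).
have Tf p q : T p q -> f p = Some q.
  by move=> Tp; apply/fE; split; [exact: T_ncmap|exists p => //; exists q].
have Dom_f : Dom f = right_ideal domT.
  apply/seteqP; split=> [x [y /fE[_ [p Tp px]]]|x [p [q Tp] [z ->]]]; first by exists p.
  exists (ncat q z); apply/fE; split; first exact/ncmap_cat/T_ncmap.
  by exists p; [exists q|exists z].
have Im_f : Im f = right_ideal imT.
  apply/seteqP; split=> [y [x /fE[xy [p [q Tp] [z ex]]]]|y [q [p Tp] [z ->]]].
    exists q; first by exists p.
    exists z; apply: (ncmap_uniq k_ge2 xy); rewrite ex; exact/ncmap_cat/T_ncmap.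
  exists (ncat p z); apply/fE; split; first exact/ncmap_cat/T_ncmap.
  by exists p; [exists q|exists z].
have domC_f : domC f domT.
  by split=> //; apply: (partitioning_maximal k_ge2).
exists f; split; [split|].
- split.
  + move=> x y w /fE[xy [p Tp [z ex]]]; apply/fE; split; first exact: ncmap_cat.
    exists p => //; exists (ncat z w); rewrite ex.
    by apply/ffunP => i; rewrite !ffunE catA.
  + move=> x x' y /fE[xy _] /fE[xy' _]; apply: (nocat_eq k_ge2) => u.
    by apply: (bij_inj phi_bij); rewrite xy xy'.
  + by exists domT.
  + by exists imT; split=> //; apply: (partitioning_maximal k_ge2).
- by move=> P _ p q u _ /fE[+ _]; apply.
move=> P [_ [jP _] eP]; case: domC_f => _ [jT _] eT.
have PE : P = domT.
  by apply/seteqP; split; apply: (joinless_sub k_ge2); rewrite // -eP -eT.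
move=> p q; rewrite PE; split=> [Tp|[[q' Tq'] fq]]; first by split; [exists q|exact: Tf].
by have := Tf _ _ Tq'; rewrite fq => -[->].
Qed.

(** Any permutation with table [T] agrees with [phi] on each domain cone, and these cones cover the
    space, so [xget] has only one possible value. *)
Lemma of_table_eq : of_table T = phi.
Proof.
rewrite /of_table; apply: xget_unique; first exact: table_represents.
move=> psi [f [[[_ _ [P dP] _] om] tab]]; apply: funext => w.
have [u ->] := rep_cone w; have [q Tq] := rep_T w.
have [Pp fp] := (tab P dP _ _).1 Tq.
by rewrite (om P dP _ _ u Pp fp) (T_ncmap Tq).
Qed.

End Representation.

Definition conic L phi :=
  forall p, (forall i, size (p i) = L) -> exists q, ncmap phi p q.

(** If [L] bounds the lengths in the domain code, a tuple of words of length [L] meets some code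
    word and therefore extends it. Conversely, the grid of length [L] is itself the domain code of a
    table for [phi]. *)
Lemma BHTP phi : BHT n k phi <-> bijective phi /\ exists L, conic L phi.
Proof.
split=> -[bij].
  move=> [f [[_ _ [P dP] _] om]]; split=> //.
  have [fP mP eP] := dP; have [L LP] := finite_bounded fP; exists L => p sp.
  have [q Pq [w [pw qw]]] := maximal_meet k_ge2 p mP.
  have [|z ez] := cone_init_le qw pw; first by move=> i; rewrite sp LP.
  have : Dom f q.
    rewrite eP; exists q => //; exists (nempty n k).
    by apply/ffunP => i; rewrite !ffunE cats0.
  case=> r fr; exists (ncat r z); rewrite ez; apply: ncmap_cat => u.
  exact: (om P dP _ _ u Pq fr).
move=> [L Lphi]; split=> //.
have [|||||f [rep _]] := @table_represents phi
    (fun p q => (forall i, size (p i) = L) /\ ncmap phi p q) (trunc L) bij _ _ _ _ _.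
- apply: sub_finite_set (@bounded_finite n k L) => p [q [h _]] i; by rewrite h.
- move=> p q w [sp _] pw; apply: (cone_size_eq pw (cone_trunc L w)) => i.
  by rewrite sp ffunE size_mkseq.
- exact: cone_trunc.
- have st w i : size (trunc L w i) = L by rewrite ffunE size_mkseq.
  by move=> w; have [q] := Lphi _ (st w); exists q.
- by move=> p q [].
by exists f.
Qed.

Lemma conic_ge L phi p : conic L phi -> (forall i, L <= size (p i)) ->
  exists q, ncmap phi p q.
Proof.
move=> c sp; pose p1 : nstring n k := [ffun i => take L (p i)].
have [|q hq] := c p1; first by move=> i; rewrite ffunE size_takel.
have -> : p = ncat p1 [ffun i => drop L (p i)].
  by apply/ffunP => i; rewrite !ffunE cat_take_drop.
by exists (ncat q [ffun i => drop L (p i)]); apply: ncmap_cat.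
Qed.

Lemma BHT_group : perm_group (BHT n k).
Proof.
split.
- apply/BHTP; split; first by exists id.
  by exists 0 => p _; exists p.
- move=> f g /BHTP[bf [L cf]] /BHTP[bg [M cg]]; apply/BHTP.
  split; first exact: bij_comp.
  (* The first [M] letters determine the image under [g]; the [L] remaining ones make that image
     long enough for [f]. *)
  exists (M + L) => p sp; pose p1 : nstring n k := [ffun i => take M (p i)].
  have [|q hq] := cg p1; first by move=> i; rewrite ffunE size_takel // sp leq_addr.
  pose p2 : nstring n k := [ffun i => drop M (p i)].
  have [|r hr] := conic_ge (p := ncat q p2) cf.
    by move=> i; rewrite !ffunE size_cat size_drop sp addKn leq_addl.
  exists r; apply: ncmap_comp hr.
  have -> : p = ncat p1 p2 by apply/ffunP => i; rewrite !ffunE cat_take_drop.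
  exact: ncmap_cat.
- move=> f g /BHTP[bf [L cf]] fK gK; apply/BHTP; split; first by exists f.
  have [q hq] : exists q : nstring n k -> nstring n k,
      forall p, (forall i, size (p i) = L) -> ncmap f p (q p).
    have [|q h] := @choice _ _ (fun p q => (forall i, size (p i) = L) -> ncmap f p q).
      move=> p; have [/cf[q]|h] := pselect (forall i, size (p i) = L);
        by [exists q|exists p].
    by exists q.
  have [M MP] := finite_bounded (finite_image q (@bounded_finite n k L)).
  (* As [M] bounds the lengths of the image words, the cone of [s] lies inside the image cone that
     contains its point [nocat s w0]. *)
  exists M => s ss; pose v := g (nocat s w0).
  have st i : size (trunc L v i) = L by rewrite ffunE size_mkseq.
  have h := hq _ st; have [u eu] := cone_trunc L v.
  have c1 : cone (q (trunc L v)) (nocat s w0) by exists u; rewrite -h -eu gK.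
  have [|z ez] := cone_init_le c1 (cone_nocat s w0).
    by move=> i; rewrite ss; apply: MP; exists (trunc L v) => // j; rewrite /= st.
  exists (ncat (trunc L v) z); rewrite ez; apply: ncmap_cat; exact: ncmap_inv h.
Qed.

End Tables.

(** * Generated groups, and maps of the first coordinate *)

Lemma smallest_perm_group X (S : set (X -> X)) : perm_group (smallest (@perm_group _) S).
Proof.
split=> [M [[]]//|f g Hf Hg M [hM sM]|f g Hf fK gK M [hM sM]]; case: (hM) => _ h1 h2.
  by apply: h1; [exact: Hf|exact: Hg].
exact: h2 (Hf _ (conj hM sM)) fK gK.
Qed.

Lemma perm_group_inverse X (G : set (X -> X)) f : perm_group G -> G f ->
  bijective f -> exists2 g, G g & cancel f g /\ cancel g f.
Proof. by move=> [_ _ h] Gf [g fK gK]; exists g => //; apply: h fK gK. Qed.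

Section Lift.
Variables n k : nat.
Implicit Types (g : (nat -> 'I_k) -> nat -> 'I_k) (w : nomega n.+1 k).

Definition lift1 g : nomega n.+1 k -> nomega n.+1 k :=
  fun w i => if i == 0 :> nat then g (w i) else w i.

Lemma lift1_comp f g : lift1 (f \o g) = lift1 f \o lift1 g.
Proof.
by apply: funext => w; apply: funext => i; rewrite /lift1 /=; case: eqP.
Qed.

Lemma lift1_id : lift1 id = id.
Proof.
by apply: funext => w; apply: funext => i; rewrite /lift1 /=; case: eqP.
Qed.

Lemma lift1_can f g : cancel f g -> cancel (lift1 f) (lift1 g).
Proof.
move=> K w; rewrite -[LHS]/((lift1 g \o lift1 f) w) -lift1_comp.
suff -> : g \o f = id by rewrite lift1_id.
exact: funext.
Qed.

Lemma lift1_bij g : bijective g -> bijective (lift1 g).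
Proof. by case=> h gK hK; exists (lift1 h); exact: lift1_can. Qed.

Lemma lift1_perm_group H : perm_group H -> perm_group [set g | H (lift1 g)].
Proof.
case=> H1 HM HV; split=> [|f g|f g] /=; first by rewrite lift1_id.
  by rewrite lift1_comp; exact: HM.
by move=> Hf fK gK; apply: HV Hf _ _; exact: lift1_can.
Qed.

Definition wconic L g := forall p : seq 'I_k, size p = L -> exists q, cmap g p q.

Lemma lift1_BHT (k_ge2 : 2 <= k) L g : bijective g -> wconic L g ->
  BHT n.+1 k (lift1 g).
Proof.
move=> bg cg; apply/(BHTP k_ge2); split; first exact: lift1_bij.
exists L => p sp; have [q hq] := cg _ (sp ord0).
exists [ffun i => if i == ord0 then q else p i] => u.
apply: funext => i; rewrite /lift1 /nocat ffunE -[_ == 0 :> nat]/(i == ord0).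
by case: eqP => // ->.
Qed.

End Lift.
Arguments lift1 n {k} g.

(** * The Higman-Thompson group and its finite generation *)

Section HigmanThompson.
Variable k : nat.
Hypothesis k_ge2 : 2 <= k.
Implicit Types (g : nomega 1 k -> nomega 1 k).

Definition wordmap g : (nat -> 'I_k) -> nat -> 'I_k := fun x => g (fun=> x) ord0.

Lemma fun_ord1 (w : nomega 1 k) : (fun=> w ord0) = w.
Proof. by apply: funext => i; rewrite (ord1 i). Qed.

Lemma lift1_wordmap g : lift1 0 (wordmap g) = g.
Proof.
apply: funext => w; apply: funext => i; rewrite (ord1 i) /lift1 /wordmap /=.
by rewrite fun_ord1.
Qed.

Lemma times_id_lift1 n g : times_id n.+1 g = lift1 n (wordmap g).
Proof. by []. Qed.

Lemma wordmapK f g : cancel f g -> cancel (wordmap f) (wordmap g).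
Proof. by move=> fK x; rewrite /wordmap fun_ord1 fK. Qed.

Lemma wordmap_HT g : HT k g -> bijective (wordmap g) /\ exists L, wconic L (wordmap g).
Proof.
move=> /(BHTP k_ge2)[[h gK hK] [L cg]]; split.
  by exists (wordmap h); exact: wordmapK.
exists L => p sp; have [|q hq] := cg [ffun=> p]; first by move=> i; rewrite ffunE.
exists (q ord0) => u; rewrite -[RHS]/(nocat q (fun=> u) ord0) -hq.
congr (g _ _).
by apply: funext => i; rewrite /nocat ffunE.
Qed.

Lemma wordmap_lift1 (h : (nat -> 'I_k) -> nat -> 'I_k) : wordmap (lift1 0 h) = h.
Proof. by []. Qed.

(** A word at least as long as [p] and [q] either extends one of them or is incomparable with
    both. *)
Lemma swap_wconic (p q : seq 'I_k) : incomp p q ->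
  wconic (maxn (size p) (size q)) (swap p q).
Proof.
move=> pq r sr; have [/prefixP[s ->]|npr] := boolP (prefix p r).
  by exists (q ++ s); apply: cmap_cat; apply: swap_l.
have [/prefixP[s ->]|nqr] := boolP (prefix q r).
  by exists (p ++ s); apply: cmap_cat; apply: swap_r.
have aux s : ~~ prefix s r -> size s <= size r -> incomp s r.
  move=> nsr le; rewrite /incomp nsr; apply: contra nsr => h.
  have [t et] := prefixP h; move: le; rewrite et size_cat.
  rewrite -[X in _ <= X]addn0 leq_add2l leqn0 size_eq0 => /eqP->.
  by rewrite cats0 prefix_refl.
by exists r; apply: swap_incomp; apply: aux; rewrite // sr leq_max leqnn ?orbT.
Qed.

Lemma swap_HT n (p q : seq 'I_k) : incomp p q -> BHT n.+1 k (lift1 n (swap p q)).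
Proof.
move=> pq; apply: (lift1_BHT _ k_ge2 _ (swap_wconic pq)).
exact: inv_bij (swapK pq).
Qed.

Lemma HT_finitely_generated : exists2 S, finite_set S & generates S (HT k).
Proof.
pose S := [set lift1 0 (swap pq.1 pq.2) | pq in
  [set pq : seq 'I_k * seq 'I_k |
    [/\ size pq.1 <= 3, size pq.2 <= 3 & incomp pq.1 pq.2]]].
exists S.
  apply: finite_image; pose F (b : 3.-bseq 'I_k * 3.-bseq 'I_k) := (val b.1, val b.2).
  apply: (@sub_finite_set _ _ (F @` setT)).
    move=> [p q] [/= sp sq _]; exists (Bseq sp, Bseq sq) => //.
  by apply: finite_image; exact: finite_finset.
apply/seteqP; split.
  apply: smallest_sub; first exact: (BHT_group 1 k_ge2).
  by move=> _ [[p q] [_ _ pq] <-]; apply: swap_HT.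
move=> g /wordmap_HT[bg [L cg]]; rewrite -(lift1_wordmap g).
have HG := lift1_perm_group (@smallest_perm_group _ S).
apply: (swaps_generate k_ge2 HG _ bg cg).
apply: (small_swaps k_ge2 HG) => p q sp sq pq.
by apply: sub_gen_smallest; exists (p, q).
Qed.

End HigmanThompson.

(** * Baker's maps, and generation in several coordinates *)

Definition single n k (j : 'I_n.+1) (s : seq 'I_k) : nstring n.+1 k :=
  at_coord n.+1 j.+1 s.
Notation hstr := (single ord0).

Section Generation.
Variables n k : nat.
Hypothesis k_ge2 : 2 <= k.
Implicit Types (p q r z : nstring n.+1 k) (u v w : nomega n.+1 k) (c s : seq 'I_k).
Implicit Types (phi psi : nomega n.+1 k -> nomega n.+1 k) (j : 'I_n.+1).

Lemma singleE j s i : single j s i = if i == j then s else [::].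
Proof. by rewrite /single /at_coord ffunE eqSS. Qed.

Lemma ncatE p q i : ncat p q i = p i ++ q i.
Proof. by rewrite ffunE. Qed.

Lemma nocat_single j s u i :
  nocat (single j s) u i = if i == j then ocat s (u i) else u i.
Proof. by rewrite /nocat singleE; case: ifP; rewrite ?ocat0. Qed.

Lemma cone_hstr s w : cone (hstr s) w <-> starts s (w ord0).
Proof.
split=> [/coneP/(_ ord0)|h]; first by rewrite singleE eqxx.
by apply/coneP => i; rewrite singleE; case: eqP => // ->.
Qed.

Lemma single_cat j s t : single j (s ++ t) = ncat (single j s) (single j t).
Proof. by apply/ffunP => i; rewrite ncatE !singleE; case: eqP. Qed.

Lemma single_comm j j' s t : j != j' ->
  ncat (single j s) (single j' t) = ncat (single j' t) (single j s).
Proof.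
move=> ne; apply/ffunP => i; rewrite !ncatE !singleE.
by case: eqP => [->|]; [rewrite (negPf ne) cats0|case: eqP; rewrite ?cats0].
Qed.

Lemma ncatA p q r : ncat p (ncat q r) = ncat (ncat p q) r.
Proof. by apply/ffunP => i; rewrite !ffunE catA. Qed.

Lemma lift1_ncmap g c d : cmap g c d -> ncmap (lift1 n g) (hstr c) (hstr d).
Proof.
move=> h u; apply: funext => i; rewrite /lift1 -[_ == 0 :> nat]/(i == ord0).
by rewrite !nocat_single; case: eqP => // ->; rewrite h.
Qed.

(* The conditional baker's map at the cone [c]: the first letter after the
   prefix [c] of coordinate [0] is moved to the front of coordinate [j]. *)
Definition baker c j phi :=
  [/\ bijective phi,
      forall a, ncmap phi (hstr (rcons c a)) (ncat (hstr c) (single j [:: a])) &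
      forall w, ~~ starts c (w ord0) -> phi w = w].

Definition bake c j w : nomega n.+1 k := fun i =>
  if starts c (w ord0) then
    if i == ord0 then ocat c (wdrop (size c).+1 (w i))
    else if i == j then ocat [:: w ord0 (size c)] (w i) else w i
  else w i.

Definition unbake c j w : nomega n.+1 k := fun i =>
  if starts c (w ord0) then
    if i == ord0 then ocat (rcons c (w j 0)) (wdrop (size c) (w i))
    else if i == j then wdrop 1 (w i) else w i
  else w i.

Lemma cons_wdrop (x : nat -> 'I_k) : ocat [:: x 0] (wdrop 1 x) = x.
Proof. by rewrite (ocat_wdrop (s := [:: x 0])) // /starts. Qed.

Lemma ocat_rcons c a x : ocat (rcons c a) x (size c) = a.
Proof. by rewrite /ocat nth_rcons ltnn eqxx. Qed.

Lemma wdropS m (x : nat -> 'I_k) : ocat [:: x m] (wdrop m.+1 x) = wdrop m x.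
Proof.
rewrite -[RHS]cons_wdrop /wdrop addn0; congr (ocat _ _).
by apply: funext => t; rewrite addSnnS.
Qed.

Lemma bakeK c j : j != ord0 -> cancel (bake c j) (unbake c j).
Proof.
move=> j0 w; have j0' := negPf j0; apply: funext => i.
have [cw|/negPf cw] := boolP (starts c (w ord0)); last by rewrite /unbake /bake !cw.
rewrite /unbake /bake cw eqxx starts_ocat j0' eqxx.
case: (eqVneq i ord0) => [->|i0].
  rewrite wdrop_ocat -cats1 ocat_cat /= [X in ocat [:: X]]/ocat /=.
  by rewrite wdropS ocat_wdrop.
by case: (eqVneq i j) => [->|//]; rewrite (wdrop_ocat [:: _]).
Qed.

Lemma unbakeK c j : j != ord0 -> cancel (unbake c j) (bake c j).
Proof.
move=> j0 w; have j0' := negPf j0; apply: funext => i.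
have [cw|/negPf cw] := boolP (starts c (w ord0)); last by rewrite /unbake /bake !cw.
have sc : starts c (ocat (rcons c (w j 0)) (wdrop (size c) (w ord0))).
  by rewrite -cats1 ocat_cat.
rewrite /unbake /bake cw !eqxx sc.
case: (eqVneq i ord0) => [->|i0].
  by rewrite -(size_rcons c (w j 0)) wdrop_ocat ocat_wdrop.
case: (eqVneq i j) => [->|//].
by rewrite ?j0' ?eqxx ocat_rcons cons_wdrop.
Qed.

Lemma baker_bake c j : j != ord0 -> baker c j (bake c j).
Proof.
move=> j0; split.
- by exists (unbake c j); [exact: bakeK|exact: unbakeK].
- move=> a u; apply: funext => i; rewrite /bake nocat_cat.
  have E : nocat (hstr (rcons c a)) u ord0 = ocat (rcons c a) (u ord0).
    by rewrite nocat_single eqxx.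
  rewrite E -cats1 ocat_cat starts_ocat -ocat_cat cats1.
  rewrite !nocat_single; case: (eqVneq i ord0) => [->|i0].
    by rewrite eq_sym (negPf j0) -(size_rcons c a) wdrop_ocat.
  case: (eqVneq i j) => // ->.
  by rewrite ocat_rcons.
- by move=> w /negPf cw; apply: funext => i; rewrite /bake cw.
Qed.

(** The swap carries the cone of [c] to that of [d], where [phi] acts, and back; a point outside the
    cone of [c] is moved off the cone of [d], where [phi] is the identity. *)
Lemma baker_conj c d j phi : incomp c d -> baker d j phi ->
  baker c j (lift1 n (swap c d) \o phi \o lift1 n (swap c d)).
Proof.
move=> cd [bphi phid phi0]; have sK := swapK cd.
have bs : bijective (lift1 n (swap c d)) by apply/lift1_bij/inv_bij.
have l := lift1_can sK.
split; first by apply: bij_comp => //; apply: bij_comp.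
  move=> a; apply: ncmap_comp (_ : ncmap _ _ (hstr (rcons d a))) _.
    by apply: lift1_ncmap; rewrite -!cats1; apply/cmap_cat/swap_l.
  by apply: ncmap_comp (phid a) _; apply/ncmap_cat/lift1_ncmap/swap_r.
move=> w ncw /=; have e0 : lift1 n (swap c d) w ord0 = swap c d (w ord0) by [].
rewrite phi0 ?l // e0; apply: contra ncw => /startsP[u e].
by rewrite -(sK (w ord0)) e swap_r.
Qed.

Section Group.
Variable H : set (nomega n.+1 k -> nomega n.+1 k).
Hypothesis H_group : perm_group H.
Hypothesis H_sub : H `<=` BHT n.+1 k.
Hypothesis H_HT : forall g, HT k g -> H (times_id n.+1 g).

Let H1 : H id. Proof. by case: H_group. Qed.
Let HM f g : H f -> H g -> H (f \o g). Proof. by case: H_group => _ h _; exact: h. Qed.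
Let H_bij f : H f -> bijective f. Proof. by move=> /H_sub[]. Qed.

Let H_swap c d : incomp c d -> H (lift1 n (swap c d)).
Proof.
move=> cd; rewrite -(wordmap_lift1 (swap c d)) -times_id_lift1.
by apply: H_HT; apply: swap_HT.
Qed.

Hypothesis H_baker0 : forall j, j != ord0 -> exists2 phi, H phi & baker [::] j phi.
Hypothesis H_baker1 : forall j, j != ord0 ->
  exists2 phi, H phi & exists2 l, is_last l & baker [:: l] j phi.

(** A nonempty [c] not starting with [l] is incomparable with [[:: l]], and one conjugation
    suffices. If [c] starts with [l], the map is first moved to [[:: a]] for another letter [a], and
    from there to [c]. *)
Lemma H_baker c j : j != ord0 -> exists2 phi, H phi & baker c j phi.
Proof.
move=> j0; case: c => [|b c]; first exact: H_baker0.
have [phi Hphi [l _ bl]] := H_baker1 j0.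
have conj c' d psi : incomp c' d -> H psi -> baker d j psi ->
    exists2 phi, H phi & baker c' j phi.
  move=> cd Hpsi bd; have Hs := H_swap cd.
  by exists (lift1 n (swap c' d) \o psi \o lift1 n (swap c' d));
    [apply: HM => //; exact: HM|exact: baker_conj].
have inc a a' s s' : a != a' -> incomp (a :: s) (a' :: s').
  by move=> /negPf ne; rewrite /incomp /= ne eq_sym ne.
have [e|ne] := eqVneq b l; last by apply: conj Hphi bl; exact: inc.
have [a na] := letter_neq l k_ge2.
have [psi Hpsi bpsi] := conj [:: a] _ _ (inc _ _ _ _ na) Hphi bl.
by apply: conj Hpsi bpsi; apply: inc; rewrite e eq_sym.
Qed.

(* One inverse baker's map at [c] for each letter of [x] outside coordinate [0]. *)
Lemma H_box c (m : 'I_n.+1 -> nat) : exists d, [/\ H d,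
  forall w, ~~ starts c (w ord0) -> d w = w &
  forall x : nstring n.+1 k, (forall i, size (x i) = m i) ->
    exists y, ncmap d (ncat (hstr c) x) (hstr (c ++ y))].
Proof.
have [N] := ubnP (\sum_i m i); elim: N m => // N IH m sN.
have [/existsP[j mj]|] := boolP [exists j, m j != 0]; last first.
  rewrite negb_exists => /forallP m0; exists id; split=> // x sx; exists [::].
  have -> : ncat (hstr c) x = hstr (c ++ [::]); last by [].
  apply/ffunP => i; rewrite ncatE !singleE cats0.
  have -> : x i = [::].
    by apply: size0nil; rewrite sx; apply/eqP; rewrite -[_ == _]negbK m0.
  by rewrite cats0.
pose m' i := if i == j then (m j).-1 else m i.
have [|d [Hd d0 dx]] := IH m'.
  rewrite (bigD1 j) //= in sN; rewrite (bigD1 j) //= /m' eqxx.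
  rewrite -ltnS (leq_trans _ sN) // ltnS -addSn prednK ?lt0n // leq_add2l.
  by rewrite leq_eqVlt; apply/orP; left; apply/eqP/eq_bigr => i /negPf->.
(* The last letter is split off, so that the map obtained for [x'] extends by [ncmap_cat]. *)
have split_x (x : nstring n.+1 k) : (forall i, size (x i) = m i) -> exists x' a,
    x = ncat x' (single j [:: a]) /\ forall i, size (x' i) = m' i.
  move=> sx; case/lastP e : (x j) => [|s a].
    by move: mj; rewrite -sx e.
  exists [ffun i => if i == j then s else x i], a; split.
    apply/ffunP => i; rewrite ncatE singleE ffunE; case: eqP => [->|_].
      by rewrite e cats1.
    by rewrite cats0.
  by move=> i; rewrite ffunE /m'; case: eqP => //; rewrite -sx e size_rcons.
(* A letter already in coordinate [0] only has to be appended to [y]. *)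
have [j0|j0] := eqVneq j ord0.
  exists d; split=> // x /split_x[x' [a [-> /dx[y dy]]]]; exists (rcons y a).
  by rewrite ncatA -cats1 catA single_cat -j0; apply: ncmap_cat; rewrite j0.
(* Once [d] has coded [x'] by [y], the letter [a] is at the front of coordinate [j]; the inverse
   baker's map [psi] inserts it right after [c], before [y]. *)
have [phi Hphi [bphi phia phi0]] := H_baker c j0.
have [psi Hpsi [K K']] := perm_group_inverse H_group Hphi bphi.
exists (psi \o d); split; first exact: HM.
  by move=> w cw /=; rewrite d0 // -{1}(phi0 w cw) K.
move=> x /split_x[x' [a [-> /dx[y dy]]]]; exists (a :: y).
rewrite ncatA; apply: (ncmap_comp (ncmap_cat _ dy)).
apply: (ncmap_inv K).
rewrite -cat_rcons !single_cat -ncatA [ncat (hstr y) _]single_comm 1?eq_sym //.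
by rewrite ncatA; apply: ncmap_cat; exact: phia.
Qed.

(** The product of all [d t]. Each [d t] is injective and fixes everything outside its cone, so it
    preserves that cone, and the other factors, supported on disjoint cones, do not interfere. *)
Lemma H_glue (T : finType) (c : T -> seq 'I_k) (d : T -> _) :
  (forall t t' w, starts (c t) (w ord0) -> starts (c t') (w ord0) -> t = t') ->
  (forall t, H (d t)) -> (forall t w, ~~ starts (c t) (w ord0) -> d t w = w) ->
  exists2 D, H D & forall t w, starts (c t) (w ord0) -> D w = d t w.
Proof.
move=> dis Hd d0.
suff [D [HD Ds _]] : exists D, [/\ H D,
    forall t w, t \in enum T -> starts (c t) (w ord0) -> D w = d t w &
    forall w, (forall t, t \in enum T -> ~~ starts (c t) (w ord0)) -> D w = w].
  by exists D => // t w; apply: Ds; rewrite mem_enum.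
elim: (enum T) => [|t s [D [HD Ds D0]]]; first by exists id.
have [ts|ts] := boolP (t \in s).
  exists D; split=> // [t' w|w h]; first by rewrite inE => /orP[/eqP->|]; exact: Ds.
  by apply: D0 => t' t's; apply: h; rewrite inE t's orbT.
have stable w : starts (c t) (w ord0) -> starts (c t) (d t w ord0).
  move=> cw; apply: contraT => nst.
  have e := bij_inj (H_bij (Hd t)) (d0 _ _ nst); by rewrite e cw in nst.
exists (D \o d t); split; first exact: HM.
- move=> t' w; rewrite inE => /predU1P[->|t's] cw /=.
    apply: D0 => r rs; apply/negP => /dis h.
    by rewrite -(h _ (stable _ cw)) rs in ts.
  rewrite d0; first exact: Ds. apply/negP => /dis h.
  by rewrite (h _ cw) t's in ts.
- move=> w h /=; rewrite d0; last by apply: h; exact: mem_head.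
  by apply: D0 => t' t's; apply: h; rewrite inE t's orbT.
Qed.

(** The local form fixes all other coordinates and makes the new first coordinate depend on the old
    one alone, so [theta] is read off on constant tuples. *)
Lemma times_id_of_conic theta : BHT n.+1 k theta ->
  (forall w, exists c d, starts c (w ord0) /\ ncmap theta (hstr c) (hstr d)) ->
  exists2 g, HT k g & theta = times_id n.+1 g.
Proof.
move=> /(BHTP k_ge2)[bt [L ct]] loc.
have rest w i : i != ord0 -> theta w i = w i.
  have [c [d [/cone_hstr[u ->] h]]] := loc w.
  by rewrite h !nocat_single => /negPf->.
have first w w' : w ord0 = w' ord0 -> theta w ord0 = theta w' ord0.
  move=> e; have [c [d [cw h]]] := loc w; have cw' := cw; rewrite e in cw'.
  move: cw cw' e => /cone_hstr[u ->] /cone_hstr[u' ->].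
  by rewrite !h !nocat_single !eqxx => /ocat_inj->.
pose g0 (x : nat -> 'I_k) := theta (fun=> x) ord0.
have theta_lift : theta = lift1 n g0.
  apply: funext => w; apply: funext => i; rewrite /lift1 -[_ == 0 :> nat]/(i == ord0).
  by case: (eqVneq i ord0) => [->|]; [exact: first|exact: rest].
have bg0 : bijective g0.
  have [th K K'] := bt.
  exists (fun x => th (fun=> x) ord0) => x; last first.
    by transitivity (theta (th (fun=> x)) ord0); [exact: first|rewrite K'].
  suff -> : th (fun=> g0 x) ord0 = x by [].
  (* The preimage of the constant tuple [g0 x] has [x] in coordinate [0] but [g0 x] elsewhere, since
     [theta] changes only coordinate [0]. *)
  have e : theta (fun i => if i == ord0 then x else g0 x) = (fun=> g0 x).
    apply: funext => i; case: (eqVneq i ord0) => [->|i0]; first exact: first.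
    by rewrite rest // (negPf i0).
  by rewrite -e K.
exists (lift1 0 g0); last by rewrite times_id_lift1 wordmap_lift1.
apply: (lift1_BHT _ k_ge2 (L := L) bg0) => p sp.
have [|q hq] := ct [ffun=> p]; first by move=> i; rewrite ffunE.
exists (q ord0) => u; rewrite -[RHS]/(nocat q (fun=> u) ord0) -hq.
by apply: first; rewrite /nocat ffunE.
Qed.

Lemma BHT_sub : BHT n.+1 k `<=` H.
Proof.
move=> phi Bphi; have /(BHTP k_ge2)[bphi [L cphi]] := Bphi.
pose T := {ffun 'I_n.+1 -> L.-tuple 'I_k}.
pose str (t : T) : nstring n.+1 k := [ffun i => val (t i)].
have sstr t i : size (str t i) = L by rewrite ffunE size_tuple.
have str_cone w : exists t, cone (str t) w.
  exists [ffun i => [tuple of mkseq (w i) L]]; apply/coneP => i.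
  by rewrite !ffunE /= starts_mkseq.
have str_inj t t' : str t = str t' -> t = t'.
  by move=> /ffunP e; apply/ffunP => i; apply: val_inj; have := e i; rewrite !ffunE.
have hstr_nil p : ncat (hstr [::]) p = p.
  by apply/ffunP => i; rewrite ncatE singleE; case: eqP.
have [h [Hh _ hL]] := H_box [::] (fun=> L).
have {}hL t : exists y, ncmap h (str t) (hstr y).
  by have [y] := hL _ (sstr t); rewrite hstr_nil; exists y.
have [c hc] := choice hL.
have [q phiq] := choice (fun t => cphi _ (sstr t)).
have [M qM] := finite_bounded (finite_image q (@finite_finset T setT)).
have {}qM t i : size (q t i) <= M by apply: qM; exists t.
have [h' [Hh' _ hM]] := H_box [::] (fun=> M).
have {}hM (x : nstring n.+1 k) :
    (forall i, size (x i) = M) -> exists y, ncmap h' x (hstr y).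
  by move=> /hM[y]; rewrite hstr_nil; exists y.
(* Completing [q t] to words of length [M] takes [M - size (q t i)] letters in coordinate [i]; [d t]
   codes a box of that shape inside the cone of [c t]. *)
have [d hd] := choice (fun t => H_box (c t) (fun i => M - size (q t i))).
have [t t' w||t|D HD Dd] := @H_glue T c d.
- move=> /cone_hstr[u eu] /cone_hstr[u' eu']; apply: str_inj.
  apply: (@cone_size_eq _ _ _ _ (nocat (str t) u)); first exact: cone_nocat.
    exists u'; apply: (bij_inj (H_bij Hh)); rewrite !hc -eu; exact: eu'.
  by move=> i; rewrite !sstr.
- by move=> t; have [] := hd t.
- by move=> w; have [_ h0 _] := hd t; exact: h0.
pose a := D \o h; have Ha : H a by apply: HM.
have [a' Ha' [aK a'K]] := perm_group_inverse H_group Ha (H_bij Ha).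
have [_ BM _] := BHT_group n.+1 k_ge2.
(* The map decodes [c t ++ y] to [str t] followed by [x], sends this to [q t] followed by [x], whose
   entries all have length [M], and codes the result by the single word [z]. *)
have [|w|g /H_HT Hg e] := @times_id_of_conic (h' \o phi \o a').
- by apply: (BM _ _ _ (H_sub Ha')); apply: (BM _ _ (H_sub Hh')).
- have [t [u eu]] := str_cone (a' w).
  pose x : nstring n.+1 k := [ffun i => mkseq (u i) (M - size (q t i))].
  have sx i : size (x i) = M - size (q t i) by rewrite ffunE size_mkseq.
  have [v ev] : cone x u by apply/coneP => i; rewrite ffunE starts_mkseq.
  have [_ _ /(_ x sx)[y dy]] := hd t; have [|z hz] := hM (ncat (q t) x).
    by move=> i; rewrite ncatE size_cat sx subnKC.
  have ax : ncmap a (ncat (str t) x) (hstr (c t ++ y)).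
    move=> u'; rewrite /a /= (ncmap_cat x (hc t)) (Dd t) ?dy //.
    by rewrite nocat_cat nocat_single eqxx.
  exists (c t ++ y), z; split; last first.
    apply: ncmap_comp (ncmap_inv aK ax) _; apply: ncmap_comp hz.
    exact: ncmap_cat.
  by rewrite -(a'K w) eu ev -nocat_cat ax nocat_single eqxx.
have [h1 Hh1 [hK _]] := perm_group_inverse H_group Hh' (H_bij Hh').
have -> : phi = h1 \o (h' \o phi \o a') \o a.
  by apply: funext => w; rewrite /= aK hK.
by apply: (HM _ Ha); apply: (HM Hh1); rewrite e.
Qed.

End Group.
End Generation.

(** * The given generators as baker's maps *)

Lemma is_last_inj k (a b : 'I_k) : is_last a -> is_last b -> a = b.
Proof.
by move=> /eqP ea /eqP eb; apply: val_inj; apply: succn_inj; rewrite ea eb.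
Qed.

Section Generators.
Variables n k : nat.
Hypothesis k_ge2 : 2 <= k.
Implicit Types (p q : nstring n.+1 k) (u v w : nomega n.+1 k) (c s : seq 'I_k).
Implicit Types (phi psi : nomega n.+1 k -> nomega n.+1 k) (j : 'I_n.+1).

(** Words one letter longer than [c] suffice: in coordinate [0] they are some [rcons c a] or their
    cone avoids that of [c]. *)
Lemma baker_BHT c j phi : baker c j phi -> BHT n.+1 k phi.
Proof.
move=> [bphi phia phi0]; apply/(BHTP k_ge2); split=> //; exists (size c).+1 => p sp.
have [/prefixP[s es]|nc] := boolP (prefix c (p ord0)); last first.
  exists p => u; apply: phi0; apply: contra nc => cu.
  by apply: starts_prefix cu (starts_ocat _ _) _; rewrite sp.
move: (sp ord0); rewrite es size_cat -addn1 => /addnI.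
case: s es => [|a [|//]] es // _; rewrite cats1 in es.
pose r : nstring n.+1 k := [ffun i => if i == ord0 then [::] else p i].
have -> : p = ncat (hstr (rcons c a)) r.
  apply/ffunP => i; rewrite ncatE singleE ffunE.
  by case: (eqVneq i ord0) => [->|]; rewrite ?cats0.
by eexists; apply: ncmap_cat; exact: phia.
Qed.

Lemma times_id_BHT g : HT k g -> BHT n.+1 k (times_id n.+1 g).
Proof.
by move=> /(wordmap_HT k_ge2)[bg [L cg]]; rewrite times_id_lift1; apply: lift1_BHT cg.
Qed.

(** The maps whose lift lies in [H] are closed under the group operations and include [Gamma]. *)
Lemma times_id_sub (H : set (nomega n.+1 k -> nomega n.+1 k)) Gamma :
  perm_group H -> generates Gamma (HT k) -> times_id n.+1 @` Gamma `<=` H ->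
  forall g, HT k g -> H (times_id n.+1 g).
Proof.
move=> HG gen sub g; rewrite -gen; apply: (_ : _ `<=` [set g | H (times_id n.+1 g)]).
apply: smallest_sub => [|h Gh]; last by apply: sub; exists h.
have [H1 HM HV] := HG; split=> [|f h|f h] /=.
- by rewrite times_id_lift1 -[wordmap id]/id lift1_id.
- rewrite !times_id_lift1 => Hf Hh.
  have -> : wordmap (f \o h) = wordmap f \o wordmap h.
    by apply: funext => x; rewrite /wordmap /= fun_ord1.
  by rewrite lift1_comp; apply: HM.
- rewrite !times_id_lift1 => Hf fK hK.
  by apply: (HV _ _ Hf); apply/lift1_can/wordmapK.
Qed.

Lemma generates_BHT Gamma S
    (H := smallest (@perm_group _) (times_id n.+1 @` Gamma `|` S)) :
  generates Gamma (HT k) -> S `<=` BHT n.+1 k ->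
  (forall j, j != ord0 -> exists2 phi, H phi & baker [::] j phi) ->
  (forall j, j != ord0 ->
    exists2 phi, H phi & exists2 l, is_last l & baker [:: l] j phi) ->
  generates (times_id n.+1 @` Gamma `|` S) (BHT n.+1 k).
Proof.
move=> gen SB H0 H1; have HG : perm_group H by apply: smallest_perm_group.
have HB : H `<=` BHT n.+1 k.
  apply: smallest_sub; first exact: BHT_group.
  move=> _ [[g Gg <-]|/SB//]; apply: times_id_BHT; rewrite -gen.
  exact: sub_gen_smallest.
apply/seteqP; split=> //; apply: BHT_sub => //.
by apply: times_id_sub gen _ => // f h; apply: sub_gen_smallest; left.
Qed.

(** For tables whose domain words sit in the first coordinate; [code x] is the domain word that
    begins [x]. *)
Lemma of_table_hstr T phi L (code : (nat -> 'I_k) -> seq 'I_k) :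
  bijective phi -> (forall p q, T p q -> ncmap phi p q) ->
  (forall p q, T p q -> exists s, [/\ p = hstr s, size s <= L &
     forall x, starts s x -> s = code x]) ->
  (forall x, starts (code x) x) -> (forall x, exists q, T (hstr (code x)) q) ->
  of_table T = phi.
Proof.
move=> bphi Tphi Tp cx cT.
apply: (of_table_eq k_ge2 (rep := fun w => hstr (code (w ord0)))) => //.
- apply: sub_finite_set (@bounded_finite n.+1 k L) => p [q /Tp[s [-> sL _]]] i.
  by rewrite singleE; case: eqP.
- by move=> p q w /Tp[s [-> _ h]] /cone_hstr/h->.
- by move=> w; apply/cone_hstr.
Qed.

(** The domain word met by [x] in the tables of both [C1] and [sigma] at level 1, which have the
    same domain code. *)
Definition code1 (x : nat -> 'I_k) :=
  if is_last (x 0) then [:: x 0; x 1] else [:: x 0].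

Lemma starts_code1 x : starts (code1 x) x.
Proof. by rewrite /code1; case: ifP => _; rewrite /starts /=. Qed.

Lemma starts1 (a : 'I_k) x : starts [:: a] x -> x 0 = a.
Proof. by rewrite /starts /= => /eqP[]. Qed.

Lemma starts2 (a b : 'I_k) x : starts [:: a; b] x -> x 0 = a /\ x 1 = b.
Proof. by rewrite /starts /= => /eqP[]. Qed.

Lemma code1_inner (a : 'I_k) x : ~~ is_last a -> starts [:: a] x -> [:: a] = code1 x.
Proof. by move=> /negPf na /starts1; rewrite /code1 => ->; rewrite na. Qed.

Lemma code1_last (l a : 'I_k) x : is_last l -> starts [:: l; a] x -> [:: l; a] = code1 x.
Proof. by move=> la /starts2[]; rewrite /code1 => -> ->; rewrite la. Qed.

Definition last_letter : 'I_k := Ordinal (etrans (ltn_predL k) (ltnW k_ge2)).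

Lemma last_letterP : is_last last_letter.
Proof. by rewrite /is_last /= prednK // ltnW. Qed.

Lemma prefix_code0 (a : 'I_k) : prefix_code 0 [:: a].
Proof.
have [la|na] := boolP (is_last a); first exact: (PrefixLast 0 la).
exact: (PrefixInner (leqnn 0) last_letterP na).
Qed.

Lemma sigma0E j : j != ord0 -> sigma n.+1 k 0 j.+1 = bake [::] j.
Proof.
move=> j0; have [bb ba _] := baker_bake ([::] : seq 'I_k) j0.
have pc0 s : prefix_code 0 s -> exists a : 'I_k, s = [:: a].
  by case=> [[|r] l a //|l _]; [exists a|exists l].
apply: (of_table_hstr (L := 1) (code := fun x => [:: x 0])) => //.
- move=> _ _ [s /pc0[a ->]]; have := ba a.
  have -> // : ncat (hstr [::]) (single j [:: a]) = single j [:: a].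
  by apply/ffunP => i; rewrite ncatE singleE; case: eqP.
- move=> _ _ [s /pc0[a ->]]; exists [:: a]; split=> // x.
  by move=> /starts1->.
- by move=> x; rewrite /starts /=.
- by move=> x; eexists; constructor; exact: prefix_code0.
Qed.

Lemma C1E j : j != ord0 -> C1 n.+1 k j.+1 = bake [:: last_letter] j.
Proof.
move=> j0; have [bb ba b0] := baker_bake [:: last_letter] j0.
apply: (of_table_hstr (L := 2) (code := code1)) => //.
- move=> _ _ [a na|l a la].
    move=> u; apply: b0; rewrite (nocat_single ord0) eqxx; apply/negP => /starts1.
    by rewrite /ocat /= => e; rewrite e last_letterP in na.
  by rewrite (is_last_inj la last_letterP); exact: ba.
- move=> _ _ [a na|l a la]; [exists [:: a]|exists [:: l; a]]; split=> // x.
    exact: code1_inner.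
  exact: code1_last.
- exact: starts_code1.
- move=> x; rewrite /code1; case: ifP => [lx|/negbT nx]; eexists.
    exact: C1Last.
  exact: C1Inner.
Qed.

(** With [l] the last letter, [C1] moves [a] out of [l a], and the level 0 map then puts [l] in
    front of it, so coordinate [j] receives [l a]. A first letter other than [l] is moved by the
    level 0 map only. *)
Lemma sigma1E j : j != ord0 ->
  sigma n.+1 k 1 j.+1 = bake [::] j \o bake [:: last_letter] j.
Proof.
move=> j0; have [bb0 ba0 _] := baker_bake ([::] : seq 'I_k) j0.
have [bb ba b0] := baker_bake [:: last_letter] j0.
have pc1 s : prefix_code 1 s -> (exists2 a : 'I_k, ~~ is_last a & s = [:: a]) \/
    exists2 a : 'I_k, True & s = [:: last_letter; a].
  case=> [[|[|//]] l a _ ll na|l ll]; first by left; exists a.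
    by right; exists a; rewrite // (is_last_inj ll last_letterP).
  by right; exists l; rewrite // (is_last_inj ll last_letterP).
have nil_single s : ncat (hstr [::]) (single j s) = single j s.
  by apply/ffunP => i; rewrite ncatE singleE; case: eqP.
apply: (of_table_hstr (L := 2) (code := code1)).
- exact: bij_comp.
- move=> _ _ [s /pc1[[a na ->]|[a _ ->]]].
    apply: (ncmap_comp (q := hstr [:: a])).
      move=> u; apply: b0; rewrite (nocat_single ord0) eqxx; apply/negP => /starts1.
      by rewrite /ocat /= => e; rewrite e last_letterP in na.
    by have := ba0 a; rewrite nil_single.
  apply: (ncmap_comp (ba a)).
  have := ncmap_cat (single j [:: a]) (ba0 last_letter).
  by rewrite nil_single -single_cat.
- move=> _ _ [s /pc1[[a na ->]|[a _ ->]]]; [exists [:: a]|exists [:: last_letter; a]];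
    split=> // x; first exact: code1_inner.
  exact: code1_last last_letterP.
- exact: starts_code1.
- move=> x; rewrite /code1; case: ifP => [lx|/negbT nx]; eexists; constructor.
    have [l1|n1] := boolP (is_last (x 1)); last exact: (PrefixInner (leqnn 1) lx n1).
    by rewrite (is_last_inj l1 lx); exact: (PrefixLast 1 lx).
  exact: (PrefixInner (leq0n 1) last_letterP nx).
Qed.

Lemma coord_ord i : 2 <= i <= n.+1 -> exists2 j : 'I_n.+1, j != ord0 & i = j.+1.
Proof. by case: i => [|[|i]] //= lt; exists (Ordinal lt). Qed.

Lemma ord_coord j : j != ord0 -> 2 <= j.+1 <= n.+1.
Proof. by move=> j0; rewrite ltnS lt0n j0 /=. Qed.

Lemma C_generates Gamma : generates Gamma (HT k) ->
  generates (times_id n.+1 @` Gamma `|`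
    [set phi | exists2 i, 2 <= i <= n.+1 &
       phi = C0 n.+1 k i \/ phi = C1 n.+1 k i]) (BHT n.+1 k).
Proof.
move=> gen; apply: generates_BHT gen _ _ _.
- move=> phi [i /coord_ord[j j0 ->] [->|->]].
    by rewrite /C0 sigma0E //; apply: baker_BHT (baker_bake _ j0).
  by rewrite C1E //; apply: baker_BHT (baker_bake _ j0).
- move=> j j0; exists (bake [::] j); last exact: baker_bake.
  apply: sub_gen_smallest; right; exists j.+1; first exact: ord_coord.
  by left; rewrite /C0 sigma0E.
- move=> j j0; exists (bake [:: last_letter] j).
    apply: sub_gen_smallest; right; exists j.+1; first exact: ord_coord.
    by right; rewrite C1E.
  by exists last_letter; [exact: last_letterP|exact: baker_bake].
Qed.

Lemma sigma_generates Gamma : generates Gamma (HT k) ->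
  generates (times_id n.+1 @` Gamma `|`
    [set phi | exists2 i, 2 <= i <= n.+1 &
       phi = sigma n.+1 k 0 i \/ phi = sigma n.+1 k 1 i]) (BHT n.+1 k).
Proof.
move=> gen; apply: generates_BHT gen _ _ _.
- move=> phi [i /coord_ord[j j0 ->] [->|->]].
    by rewrite sigma0E //; apply: baker_BHT (baker_bake _ j0).
  rewrite sigma1E //; have [_ h _] := BHT_group n.+1 k_ge2.
  by apply: h; apply: baker_BHT (baker_bake _ j0).
- move=> j j0; exists (bake [::] j); last exact: baker_bake.
  apply: sub_gen_smallest; right; exists j.+1; first exact: ord_coord.
  by left; rewrite sigma0E.
- move=> j j0; exists (bake [:: last_letter] j); last first.
    by exists last_letter; [exact: last_letterP|exact: baker_bake].
  set H := smallest _ _; have HG : perm_group H by apply: smallest_perm_group.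
  have H0 : H (bake [::] j).
    apply: sub_gen_smallest; right; exists j.+1; first exact: ord_coord.
    by left; rewrite sigma0E.
  have [bb _ _] := baker_bake ([::] : seq 'I_k) j0.
  have [psi Hpsi [K _]] := perm_group_inverse HG H0 bb.
  (* By [sigma1E], undoing the level 0 map after the level 1 map recovers [C1]. *)
  have -> : bake [:: last_letter] j = psi \o sigma n.+1 k 1 j.+1.
    by rewrite sigma1E //; apply: funext => w /=; rewrite K.
  case: (HG) => _ h _; apply: h => //.
  apply: sub_gen_smallest; right; exists j.+1; first exact: ord_coord.
  by right.
Qed.

End Generators.

(** * Counting generators, and the theorem *)

Lemma finite_generated_by_card X (G S : set (X -> X)) :
  finite_set S -> generates S G -> exists d, generated_by_card G d.
Proof. by move=> /finite_setP[d Sd] gen; exists d, S. Qed.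

Lemma min_generators_exists X (G : set (X -> X)) :
  (exists d, generated_by_card G d) -> exists d, min_generators G d.
Proof.
move=> [d Gd]; have h : exists d, `[< generated_by_card G d >] by exists d; apply/asboolP.
exists (ex_minn h); case: ex_minnP => m /asboolP Gm mm; split=> // d' /asboolP.
exact: mm.
Qed.

Theorem theorem3p12 (n k : nat) (n_ge1 : 1 <= n) (k_ge2 : 2 <= k) :
  [/\ exists2 S, finite_set S & generates S (BHT n k),
      forall Gamma, finite_set Gamma -> generates Gamma (HT k) ->
        generates (times_id n @` Gamma `|`
                   [set phi | exists2 i, 2 <= i <= n &
                      phi = C0 n k i \/ phi = C1 n k i]) (BHT n k) /\
        generates (times_id n @` Gamma `|`
                   [set phi | exists2 i, 2 <= i <= n &
                      phi = sigma n k 0 i \/ phi = sigma n k 1 i]) (BHT n k) &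
      exists N M, [/\ min_generators (HT k) N, min_generators (BHT n k) M &
                      M <= N + 2 * (n - 1)]].
Proof.
case: n n_ge1 => [//|n _].
have [S0 fS0 gen0] := HT_finitely_generated k_ge2.
have [N [[S cS genS] minN]] := min_generators_exists (finite_generated_by_card fS0 gen0).
pose U := times_id n.+1 @` S `|` [set phi | exists2 i, 2 <= i <= n.+1 &
  phi = C0 n.+1 k i \/ phi = C1 n.+1 k i].
have genU : generates U (BHT n.+1 k) by apply: C_generates.
have cU : (U #<= `I_(N + 2 * (n.+1 - 1)))%card.
  have /card_set_bijP[b [bS b_inj _]] := cS.
  pose s t := @xget (nomega 1 k -> nomega 1 k) id [set g | S g /\ b g = t].
  have sb g : S g -> s (b g) = g.
    by move=> Sg; apply: xget_unique => // h [Sh]; apply: b_inj; exact: mem_set.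
  (* The first [N] indices list [S], the next [n] the maps [C0] and the last [n] the maps [C1]. The
     dimension is [n.+1], and coordinates from 2 on occur, hence the shift by 2. *)
  pose F t := if t < N then times_id n.+1 (s t)
    else if t < N + n then C0 n.+1 k (t - N).+2 else C1 n.+1 k (t - (N + n)).+2.
  apply: card_le_trans (card_image_le F _); apply: subset_card_le.
  rewrite subn1 /= mul2n -addnn => phi [[g Sg <-]|[i /andP[i2 iN]]].
    have bN : b g < N by apply: bS.
    by exists (b g); rewrite /= ?/F ?bN ?sb // ltn_addr.
  have i2n : i - 2 < n by rewrite ltn_subLR.
  case=> ->.
    exists (N + (i - 2)) => /=; first by rewrite ltn_add2l ltn_addr.
    by rewrite /F ltnNge leq_addr /= ltn_add2l i2n addKn -addn2 subnK.
  exists (N + n + (i - 2)) => /=; first by rewrite -addnA !ltn_add2l.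
  by rewrite /F !ltnNge leq_addr -addnA leq_addr addnA /= addKn -addn2 subnK.
have fU : finite_set U by apply: card_le_finite cU _.
split.
- by exists U.
- move=> Gamma _ gen; split; [exact: C_generates|exact: sigma_generates].
have [M mM] := min_generators_exists (finite_generated_by_card fU genU).
exists N, M; split=> //; first by split=> //; exists S.
(* Listed generators might coincide, so the exact cardinality [d] of [U] is compared with the bound
   through [cU]. *)
have [d Ud] := (finite_setP U).1 fU; have [_ minM] := mM.
apply: leq_trans (minM d _) _; first by exists U.
by rewrite -card_le_II -(card_le_eql Ud).
Qed.
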